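(* Let $T$ be a regular tournament of order $2n+1\geq 11$ and let $S$ be a subset of $V(T)$ with $|S|\leq \frac{1}{2}(n-2)$. Let $x,y$ be two distinct vertices in $V(T)\setminus S$. If the subtournament $T-S$ contains an $(x,y)$-path of length $r$, where $r\in [3, 2n-|S|-1]$, then $T-S$ also contains an $(x,y)$-path of length $r+1$.
   Context: A tournament is an orientation of a complete graph; it is regular if every vertex has outdegree equal to its indegree. $T-S$ denotes the subtournament induced by $V(T)\setminus S$. Paths are directed and simple; the length of a path is its number of arcs; an $(x,y)$-path is a path from $x$ to $y$. $[a,b]$ denotes the set of integers $\{a,a+1,\dots,b\}$. *)

(* Defs.v *)
From mathcomp Require Import all_boot.
Set Implicit Arguments. Unset Strict Implicit. Unset Printing Implicit Defensive.

Definition is_tournament (V : finType) (t : rel V) : Prop :=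
  (forall v, ~~ t v v) /\
  (forall u v, u != v -> (t u v && ~~ t v u) || (t v u && ~~ t u v)).

Definition outdeg (V : finType) (t : rel V) (v : V) : nat := #|[set w | t v w]|.
Definition indeg (V : finType) (t : rel V) (v : V) : nat := #|[set w | t w v]|.

Definition is_regular (V : finType) (t : rel V) : Prop :=
  forall v, outdeg t v = indeg t v.

(* x :: p is a directed simple (x,y)-path of length size p (number of arcs)
   in the subtournament T - S induced by V \ S. *)
Definition path_avoiding (V : finType) (t : rel V) (S : {set V})
  (x y : V) (p : seq V) : Prop :=
  [/\ path t x p, uniq (x :: p), last x p = y & all (fun v => v \notin S) (x :: p)].

Definition has_path_of_length (V : finType) (t : rel V) (S : {set V})
  (x y : V) (r : nat) : Prop :=
  exists p : seq V, path_avoiding t S x y p /\ size p = r.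

(* Main.v *)
Require Import Defs.
From mathcomp Require Import all_boot zify.
Set Implicit Arguments. Unset Strict Implicit. Unset Printing Implicit Defensive.

(** Write [D] for the vertex set of [T - S], [d = n - |S|] and [m = |D|]. All in-
    and outdegrees in [T - S] are at least [d], while [m <= 3 d - 1] and [d >= 4].
    Two disjoint paths with common ends can be shuffled into one path through the
    vertices of both, since consecutive heads of the two paths are comparable.

    Let [P = v_0 .. v_r] be the given path and suppose that there is no path of
    length [r + 1]. A vertex [u] outside [P] cannot be inserted, so it dominates
    exactly [v_0, .., v_(k-1)] for some threshold [k]. If [P] misses an outneighbour
    of [x] and an inneighbour of [y], the thresholds force two disjoint large sets
    outside [P], which is impossible. Two disjoint [(x,y)]-paths that have together
    as many inner vertices as [P] can always be lengthened by one vertex, so no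
    inneighbour of [y] is followed on [P] by an outneighbour of [x]; with this,
    counting the arcs that leave the interior of [P] shows that [P] contains all
    outneighbours of [x] and all inneighbours of [y], and then that [r >= 2 d - 2].

    For such [r] we use three disjoint [(x,y)]-paths, which exist by Hall's theorem.
    If they have at most [r] inner vertices, then a chain of the right length in
    the remaining tournament can be absorbed by the triple; the chain is a segment
    of a Hamiltonian path or cycle of what remains. If they have a few vertices too
    many, then a prefix and a suffix of the longest path are merged with the other
    two; and if there are many too many, the triple can be shortened. *)

(** * Shuffling paths *)

Definition tournament (V : finType) (t : rel V) : Prop :=
  (forall v, t v v = false) /\ (forall u v, u != v -> t u v = ~~ t v u).

Definition converse (V : finType) (t : rel V) : rel V := fun u v => t v u.

(* [p] lists the inner vertices only: the path is [a :: rcons p b]. *)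
Definition pth (V : finType) (t : rel V) (a b : V) (p : seq V) : bool :=
  path t a (rcons p b).

(** The order of the inner vertices is forgotten: the merging arguments only keep track of which
    vertices a path uses. *)
Definition linked (V : finType) (t : rel V) (a b : V) (s : seq V) : Prop :=
  exists2 p, pth t a b p & perm_eq p s.

Lemma converse_tournament (V : finType) (t : rel V) :
  tournament t -> tournament (converse t).
Proof.
case=> t0 tt; split=> // u v uv; rewrite /converse.
by rewrite tt // eq_sym.
Qed.

Lemma pth_converse (V : finType) (t : rel V) a b p :
  pth (converse t) b a (rev p) = pth t a b p.
Proof.
have := rev_path (converse t) a (rcons p b).
by rewrite last_rcons belast_rcons rev_cons.
Qed.

Section Links.
Variables (V : finType) (t : rel V).
Hypothesis tT : tournament t.

Lemma tourF u v : t u v -> t v u = false.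
Proof.
case: tT => t0 tt; have [->|uv] := eqVneq u v; first by rewrite t0.
by rewrite tt // => /negbTE.
Qed.

Lemma tour_neq u v : t u v -> u != v.
Proof. by apply: contraTneq => ->; case: tT => ->. Qed.

Lemma tourN u v : u != v -> ~~ t u v -> t v u.
Proof. by case: tT => _ tt uv; rewrite tt // negbK. Qed.

Lemma pth_cat a m b p q : pth t a m p -> pth t m b q -> pth t a b (p ++ m :: q).
Proof.
by rewrite /pth -cat_rcons rcons_cat cat_path last_rcons => -> ->.
Qed.

Lemma pth_split a m b p q : pth t a b (p ++ m :: q) = pth t a m p && pth t m b q.
Proof. by rewrite /pth -cat_rcons rcons_cat cat_path last_rcons. Qed.

Lemma pth_linked a b p : pth t a b p -> linked t a b p.
Proof. by exists p. Qed.

Lemma linked_perm a b s s' : perm_eq s s' -> linked t a b s -> linked t a b s'.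
Proof. by move=> ss' [p pp ps]; exists p => //; apply: perm_trans ps ss'. Qed.

Lemma linked_cat a m b s s' :
  linked t a m s -> linked t m b s' -> linked t a b (s ++ m :: s').
Proof.
move=> [p pp ps] [q pq qs]; exists (p ++ m :: q); first exact: pth_cat.
by rewrite perm_cat // perm_cons.
Qed.

(** Of the two heads one dominates the other; it comes next and takes the role of [a], since it
    precedes what is left of both lists. Once one list is used up, the other leads to [b]. *)
Lemma merge_pth a b p c : pth t a b p -> pth t a b c ->
  ~~ has [in p] c -> linked t a b (p ++ c).
Proof.
have [n] := ubnP (size p + size c).
elim: n a p c => // n IH a [|h p] c sz pp pc dis.
  by exists c.
case: c pc dis sz => [|g c] pc dis sz; first by exists (h :: p); rewrite ?cats0.
move: dis; rewrite /= negb_or inE negb_or => /andP[/andP[gh gp] dis].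
move: (pp) (pc); rewrite /pth /= => /andP[ah ph] /andP[ag pg].
have [hg|/tourN gh'] := boolP (t h g).
  have [||||s ps e] := IH h p (g :: c).
  - by move: sz => /=; lia.
  - exact: ph.
  - by rewrite /pth /= hg.
  - rewrite /= negb_or gp /=; apply: contra dis => /hasP[z zc zp].
    by apply/hasP; exists z => //; rewrite inE zp orbT.
  by exists (h :: s); rewrite ?perm_cons //= /pth /= ah.
have gh2 : t g h by apply: gh'; rewrite eq_sym.
have [||||s ps e] := IH g (h :: p) c.
- by move: sz => /=; lia.
- by rewrite /pth /= gh2.
- exact: pg.
- exact: dis.
exists (g :: s); first by rewrite /pth /= ag.
rewrite -cat_cons perm_sym perm_catC /= perm_cons perm_sym.
by apply: perm_trans e _; rewrite perm_catC.
Qed.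

Lemma linked_merge a b s s' : linked t a b s -> linked t a b s' ->
  uniq (s ++ s') -> linked t a b (s ++ s').
Proof.
move=> [p pp ps] [q pq qs]; rewrite cat_uniq => /and3P[_ dis _].
apply: linked_perm (merge_pth pp pq _); first by rewrite perm_cat.
apply: contra dis => /hasP[z]; rewrite (perm_mem qs) => zs' zp.
by apply/hasP; exists z; rewrite -?(perm_mem ps).
Qed.

Lemma linked_mem a b s z : linked t a b s -> z \in s ->
  exists s1 s2, [/\ linked t a z s1, linked t z b s2 & perm_eq s (s1 ++ z :: s2)].
Proof.
move=> [p pp ps]; rewrite -(perm_mem ps) => zp.
case/splitPr: zp pp ps => p1 p2; rewrite pth_split => /andP[h1 h2] ps.
by exists p1, p2; split; [exists p1|exists p2|rewrite perm_sym].
Qed.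

(** The chain [c] runs parallel to the part of the path before [z], so it is merged with that part
    only. *)
Lemma linked_head a b s z c : linked t a b s -> z \in s -> linked t a z c ->
  uniq (s ++ c) -> linked t a b (s ++ c).
Proof.
move=> Ls zs Lc; have [s1 [s2 [L1 L2 e]]] := linked_mem Ls zs => u.
have e2 : perm_eq (s ++ c) ((s1 ++ c) ++ z :: s2).
  rewrite (perm_trans (y := (s1 ++ z :: s2) ++ c)) ?perm_cat2r //.
  by rewrite -!catA perm_cat2l perm_catC.
apply: linked_perm (_ : perm_eq ((s1 ++ c) ++ z :: s2) _) _.
  by rewrite perm_sym.
apply: linked_cat => //; apply: linked_merge => //.
by move: u; rewrite (perm_uniq e2) cat_uniq => /and3P[].
Qed.

Lemma linked_tail a b s z c : linked t a b s -> z \in s -> linked t z b c ->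
  uniq (s ++ c) -> linked t a b (s ++ c).
Proof.
move=> Ls zs Lc; have [s1 [s2 [L1 L2 e]]] := linked_mem Ls zs => u.
have e2 : perm_eq (s ++ c) (s1 ++ z :: (s2 ++ c)).
  rewrite (perm_trans (y := (s1 ++ z :: s2) ++ c)) ?perm_cat2r //.
  by rewrite -catA.
apply: linked_perm (_ : perm_eq (s1 ++ z :: (s2 ++ c)) _) _.
  by rewrite perm_sym.
apply: linked_cat => //; apply: linked_merge => //.
by move: u; rewrite (perm_uniq e2) cat_uniq => /and3P[_ _ /= /andP[]].
Qed.

(** Split the paths into [s1], [z], [s2] and [s1'], [z'], [s2']. Both [s1], [z], [c] and [s1'] lead
    from [a] to [z']; they are merged and continued by [z'], [s2']. Finally [s2], which leads from
    [z] to [b], is merged in as a tail. *)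
Lemma linked_cross a b s s' z z' c : linked t a b s -> linked t a b s' ->
  z \in s -> z' \in s' -> linked t z z' c ->
  uniq (s ++ s' ++ c) -> linked t a b (s ++ s' ++ c).
Proof.
move=> Ls Ls' zs zs' Lc u.
have [s1 [s2 [L1 L2 e]]] := linked_mem Ls zs.
have [s1' [s2' [L1' L2' e']]] := linked_mem Ls' zs'.
have e3 : perm_eq (s ++ s' ++ c) ((((s1 ++ z :: c) ++ s1') ++ z' :: s2') ++ s2).
  apply: (perm_trans (y := (s1 ++ z :: s2) ++ (s1' ++ z' :: s2') ++ c)).
    by rewrite perm_cat // perm_cat.
  apply/permP=> f; rewrite ?count_cat /= ?count_cat /=; lia.
move: u; rewrite (perm_uniq e3) => u.
apply: linked_perm (_ : perm_eq ((((s1 ++ z :: c) ++ s1') ++ z' :: s2') ++ s2) _) _.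
  by rewrite perm_sym.
apply: (@linked_tail _ _ _ z) => //; last by rewrite !(mem_cat, inE) eqxx orbT.
apply: linked_cat => //; apply: linked_merge => //; first exact: linked_cat.
by move: u; rewrite !cat_uniq => /and3P[/and3P[]].
Qed.

End Links.

(** * Arcs inside a vertex set *)

Section Counting.
Variables (V : finType).
Implicit Types (t : rel V) (C E D : {set V}).

Definition outin t C (v : V) : nat := #|[set w in C | t v w]|.

Lemma outin_sum t C v : outin t C v = \sum_(w in C) t v w.
Proof.
rewrite /outin -sum1_card big_mkcond [RHS]big_mkcond /=.
by apply: eq_bigr => w _; rewrite inE; case: (w \in C); case: (t v w).
Qed.

(** Adding the same sum with the arcs reversed counts every ordered pair of distinct vertices of [C]
    once. *)
Lemma sum_outin t C : tournament t ->
  2 * \sum_(v in C) outin t C v = #|C| * #|C|.-1.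
Proof.
move=> tT; rewrite mul2n -addnn.
have -> : \sum_(v in C) outin t C v = \sum_(v in C) \sum_(w in C) t v w.
  by apply: eq_bigr => v _; rewrite outin_sum.
rewrite {2}exchange_big /= -big_split /=.
rewrite (eq_bigr (fun _ => #|C|.-1)) ?sum_nat_const // => v vC.
rewrite -big_split /= (bigD1 v) //= (proj1 tT) /= add0n.
rewrite (eq_bigr (fun _ => 1)) => [|w /andP[_ wv]].
  by rewrite sum1_card (cardsD1 v) vC; apply: eq_card => w; rewrite !inE andbC.
by rewrite (proj2 tT _ _ wv) ; case: (t v w).
Qed.

End Counting.

(** * Degrees *)

Section Degrees.
Variables (V : finType).
Implicit Types (t : rel V) (C E D J F : {set V}).

Definition mindeg t D (d : nat) : Prop :=
  forall v, v \in D -> d <= outin t D v /\ d <= outin (converse t) D v.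

Lemma mindeg_converse t D d : mindeg t D d -> mindeg (converse t) D d.
Proof. by move=> h v /h[]. Qed.

Lemma outin_le t D J F v : (forall w, w \in D -> t v w -> (w \in J) || (w \in F)) ->
  outin t D v <= outin t J v + #|F|.
Proof.
move=> h; rewrite /outin; apply: leq_trans (leq_card_setU _ _).
apply/subset_leq_card/subsetP=> w; rewrite !inE => /andP[wD vw].
by have := h w wD vw; rewrite vw andbT.
Qed.

Lemma sum_out_le t J d (f : V -> nat) : tournament t ->
  (forall v, v \in J -> d <= outin t J v + f v) ->
  2 * (d * #|J|) <= #|J| * #|J|.-1 + 2 * \sum_(v in J) f v.
Proof.
move=> tT h; rewrite -(sum_outin J tT) -mulnDr leq_mul2l /= -big_split /=.
by rewrite mulnC -sum_nat_const; apply: leq_sum.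
Qed.

(** On average a vertex of [C] has [(#|C| - 1) / 2] outneighbours in [C], and all its other
    outneighbours lie in [E]. *)
Lemma closed_out t D d C E : tournament t -> mindeg t D d -> C \subset D -> C != set0 ->
  (forall v w, v \in C -> w \in D -> t v w -> (w \in C) || (w \in E)) ->
  2 * d + 1 <= #|C| + 2 * #|E|.
Proof.
move=> tT md CD C0 h.
have := @sum_out_le t C d (fun=> #|E|) tT.
rewrite sum_nat_const => H.
have {}H : 2 * (d * #|C|) <= #|C| * #|C|.-1 + 2 * (#|C| * #|E|).
  apply: H => v vC; apply: leq_trans (proj1 (md v (subsetP CD v vC))) _.
  by apply: outin_le => w; apply: h.
have : 0 < #|C| by rewrite card_gt0.
nia.
Qed.

Lemma closed_in t D d C E : tournament t -> mindeg t D d -> C \subset D -> C != set0 ->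
  (forall v w, v \in C -> w \in D -> t w v -> (w \in C) || (w \in E)) ->
  2 * d + 1 <= #|C| + 2 * #|E|.
Proof.
by move=> tT md; apply: closed_out (converse_tournament tT) (mindeg_converse md).
Qed.

(** The exceptional arc adds only [1] to the whole degree sum. If the bound failed, this could
    matter only for [#|C| <= 2], and then [#|E| <= 2] contradicts [d >= 4]. *)
Lemma closed_out_but_arc t D d C E x y : tournament t -> mindeg t D d ->
  C \subset D -> C != set0 -> 4 <= d -> #|E| <= 2 ->
  (forall v w, v \in C -> w \in D -> t v w ->
     [|| w \in C, w \in E | (v == x) && (w == y)]) ->
  2 * d + 1 <= #|C| + 2 * #|E|.
Proof.
move=> tT md CD C0 d4 E2 h.
have H : 2 * (d * #|C|) <= #|C| * #|C|.-1 + 2 * \sum_(v in C) (#|E| + (v == x)).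
  apply: (sum_out_le tT) => v vC; apply: leq_trans (proj1 (md v (subsetP CD v vC))) _.
  apply: leq_trans (outin_le (J := C) (F := E :|: (if v == x then [set y] else set0)) _) _.
    move=> w wD vw; have := h v w vC wD vw; rewrite !inE.
    by case: (v == x); rewrite ?inE //=; case/orP=> [->|/orP[->|]]; rewrite ?orbT ?orbF.
  rewrite leq_add2l; apply: leq_trans (leq_card_setU _ _) _.
  by case: (v == x); rewrite ?cards1 ?cards0.
have H2 : \sum_(v in C) (#|E| + (v == x)) <= #|C| * #|E| + 1.
  rewrite big_split /= sum_nat_const leq_add2l.
  rewrite -big_mkcondr /= sum1_card -(cards1 x); apply/subset_leq_card/subsetP=> v.
  by rewrite !inE => /andP[].
have C1 : 0 < #|C| by rewrite card_gt0.
move: H H2 C1 E2 d4; move: #|C| #|E| (\sum_(v in C) _).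
clear=> c e s H H2 c0 E2 d4; rewrite leqNgt; apply/negP=> h.
have {}h : c + 2 * e <= 2 * d by lia.
have h1 : c * (c + 2 * e) <= c * (2 * d) by rewrite leq_mul2l h orbT.
have h2 : c * c.-1 = c * c - c by case: (c) => // j; rewrite /= mulnS; lia.
have h3 : c <= c * c by case: (c) => // j; rewrite mulnS; lia.
have c2 : c <= 2 by lia.
have [c1|{}c2] : c = 1 \/ c = 2 by lia.
  by rewrite c1 in H H2; lia.
by rewrite c2 in H H2; lia.
Qed.

(** The rest [D :\: (C :|: E)] sends arcs only to itself and to [E]. So it has at least [2 d - 1]
    vertices, as does [C], too many for [D]. *)
Lemma cut_bound t D d C E : tournament t -> mindeg t D d -> C \subset D ->
  C != set0 -> D :\: (C :|: E) != set0 -> #|E| = 1 -> #|D| + 1 <= 3 * d -> 1 < d ->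
  (forall v w, v \in C -> w \in D -> t w v -> (w \in C) || (w \in E)) -> False.
Proof.
move=> tT md CD C0 F0 E1 mD d1 h.
have h1 := closed_in tT md CD C0 h.
have h2 : 2 * d + 1 <= #|D :\: (C :|: E)| + 2 * #|E|.
  apply: (closed_out tT md _ F0); first exact: subsetDl.
  move=> v w; rewrite !inE negb_or => /andP[/andP[vC vE] vD] wD vw.
  rewrite wD andbT; case: (boolP (w \in E)) => _; rewrite ?orbT //= !orbF.
  by apply/negP=> wC; have := h w v wC vD vw; rewrite (negbTE vC) (negbTE vE).
have h3 : #|C| + #|D :\: (C :|: E)| <= #|D|.
  rewrite -[leqRHS](cardsID C) leq_add //.
    by rewrite subset_leq_card // subsetI CD subxx.
  by apply: subset_leq_card; rewrite setDS // subsetUl.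
lia.
Qed.

End Degrees.

(** * Replacing a segment of a path *)

Section Splice.
Variables (V : finType) (t : rel V).

(** Positions count along [x :: rcons p y]: [x] has position [0] and [y] position [(size p).+1].
    Thus [take i p] stops at position [i] and [drop j.-1 p] starts at position [j]. *)
Lemma pth_splice x y p i j c : pth t x y p -> i < j -> j <= (size p).+1 ->
  pth t (nth x (x :: rcons p y) i) (nth x (x :: rcons p y) j) c ->
  pth t x y (take i p ++ c ++ drop j.-1 p).
Proof.
rewrite /pth => pp ij jp pc.
have ip : i <= size p by lia.
case: j ij jp pc => // j ij jp /= pc.
have jp' : j < size (rcons p y) by rewrite size_rcons.
have -> : rcons (take i p ++ c ++ drop j p) y = take i p ++ rcons c (nth x (rcons p y) j)
  ++ drop j.+1 (rcons p y).
  rewrite !rcons_cat cat_rcons -drop_nth // drop_rcons //; lia.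
have e : take i (rcons p y) = take i p by rewrite -cats1 takel_cat.
have el : nth x (x :: rcons p y) i = last x (take i p).
  rewrite -nth_last size_takel //; case: i ip {ij e pc} => [|i] ip /=; first by rewrite take0.
  by rewrite nth_rcons ip nth_take // (set_nth_default x).
rewrite cat_path; apply/andP; split.
  by move: pp; rewrite -[rcons p y](cat_take_drop i) cat_path e => /andP[].
rewrite cat_path -el pc last_rcons /=.
move: pp; rewrite -{1}[rcons p y](cat_take_drop j.+1) cat_path => /andP[_].
by rewrite (take_nth x) // last_rcons.
Qed.

Lemma size_splice (p c : seq V) i j : i < j -> j <= (size p).+1 ->
  size (take i p ++ c ++ drop j.-1 p) + j = size p + size c + i.+1.
Proof. by move=> ij jp; rewrite !size_cat size_takel ?size_drop; lia. Qed.

Lemma uniq_splice (p c : seq V) i j : uniq (p ++ c) -> i < j ->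
  uniq (take i p ++ c ++ drop j.-1 p).
Proof.
move=> u ij.
have e : perm_eq (take i p ++ c ++ drop j.-1 p) ((take i p ++ drop j.-1 p) ++ c).
  by apply/permP=> f; rewrite !count_cat; lia.
rewrite (perm_uniq e); apply: subseq_uniq u; apply: cat_subseq => //.
rewrite -[X in subseq _ X](cat_take_drop i p); apply: cat_subseq => //.
have -> : j.-1 = j.-1 - i + i by lia.
by rewrite -drop_drop drop_subseq.
Qed.

Lemma mem_splice (p c : seq V) i j : {subset take i p ++ c ++ drop j.-1 p <= p ++ c}.
Proof.
move=> z; rewrite !mem_cat => /orP[/mem_take -> //|/orP[->|/mem_drop ->//]].
by rewrite orbT.
Qed.

End Splice.

(** * Two disjoint paths *)

Definition inner_path (V : finType) (t : rel V) (D : {set V}) (x y : V) (p : seq V) : Prop :=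
  [/\ pth t x y p, uniq p & {subset p <= D :\: [set x; y]}].

Definition has_inner (V : finType) (t : rel V) (D : {set V}) (x y : V) (k : nat) : Prop :=
  exists2 p, inner_path t D x y p & size p = k.

(** The summand [1] accounts for a possible arc from [x] to [y]. *)
Lemma count_out_x (V : finType) (t : rel V) (D : {set V}) d (x y : V) (s : seq V) :
  tournament t -> mindeg t D d -> x \in D -> uniq s -> {subset s <= D :\: [set x; y]} ->
  d <= #|[set w in [set v in D :\: [set x; y] | v \notin s] | t x w]| + count (t x) s + 1.
Proof.
move=> tT md xD us sD; have [h _] := md x xD; apply: leq_trans h _.
set Wx := [set w in _ | t x w].
apply: leq_trans (outin_le (J := Wx :|: [set z in s | t x z]) (F := [set y]) _) _.
  move=> w wD xw; have wx : (w == x) = false by rewrite eq_sym (negbTE (tour_neq tT xw)).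
  by rewrite !in_setU !inE wD xw wx /=; case: (w == y); case: (w \in s).
rewrite cards1 leq_add2r.
apply: leq_trans (_ : #|Wx :|: [set z in s | t x z]| <= _).
  by apply/subset_leq_card/subsetP=> z; rewrite inE => /andP[].
apply: leq_trans (leq_card_setU _ _) _; rewrite leq_add2l -size_filter.
rewrite -(card_uniqP (filter_uniq (t x) us)); apply/subset_leq_card/subsetP=> z.
by rewrite inE mem_filter andbC.
Qed.

Lemma count_in_y (V : finType) (t : rel V) (D : {set V}) d (x y : V) (s : seq V) :
  tournament t -> mindeg t D d -> y \in D -> uniq s -> {subset s <= D :\: [set x; y]} ->
  d <= #|[set w in [set v in D :\: [set x; y] | v \notin s] | t w y]|
       + count (fun z => t z y) s + 1.
Proof.
rewrite setUC => tT md yD us sD.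
exact: (count_out_x (converse_tournament tT) (mindeg_converse md) yD us sD).
Qed.

Section TwoPaths.
Variables (V : finType) (t : rel V) (D : {set V}) (d : nat) (x y : V).
Hypotheses (tT : tournament t) (md : mindeg t D d) (d4 : 4 <= d).
Hypotheses (mD : #|D| + 1 <= 3 * d) (xD : x \in D) (yD : y \in D) (xy : x != y).
Let Dxy := D :\: [set x; y].

Lemma linked_has_inner (s : seq V) : linked t x y s -> uniq s -> {subset s <= Dxy} ->
  has_inner t D x y (size s).
Proof.
move=> [p pp ps] us sD; exists p; last exact: perm_size.
by split=> //; [rewrite (perm_uniq ps)|move=> z; rewrite (perm_mem ps) => /sD].
Qed.

Lemma card_Dxy : #|Dxy| + 2 = #|D|.
Proof.
have := cardsID [set x; y] D; rewrite -/Dxy (setIidPr _) ?cards2 ?xy; first by clear; lia.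
by apply/subsetP=> z; rewrite !inE => /orP[]/eqP->.
Qed.

Lemma card_outside (s : seq V) : uniq s -> {subset s <= Dxy} ->
  #|[set v in Dxy | v \notin s]| + size s + 2 = #|D|.
Proof.
move=> us sD; have := cardsID [set v in s] Dxy; have := card_Dxy.
have -> : #|Dxy :&: [set v in s]| = size s.
  rewrite -(card_uniqP us); apply: eq_card => v; rewrite in_setI inE.
  by case: (boolP (v \in s)) => [/sD->|]; rewrite ?andbF.
have -> : Dxy :\: [set v in s] = [set v in Dxy | v \notin s].
  by apply/setP=> v; rewrite in_setD !inE andbC.
clear; lia.
Qed.

Lemma mem_nth_interior (R : seq V) i z0 : 0 < i <= size R -> nth z0 (x :: rcons R y) i \in R.
Proof.
by case: i => // i /andP[_ iR] /=; rewrite nth_rcons iR mem_nth.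
Qed.

(** The chain takes the place of the second vertex of [R]; it is entered from the first vertex and
    left to the third. *)
Lemma insert_dropping_one R b c : pth t x y R -> 3 <= size R -> path t b c ->
  (forall z, z \in R -> t z b) -> (forall z, z \in R -> t (last b c) z) ->
  uniq (R ++ b :: c) -> {subset R ++ b :: c <= Dxy} ->
  has_inner t D x y (size R + size c).
Proof.
move=> pR R3 pc hb hc u sD.
have pc' : pth t (nth x (x :: rcons R y) 1) (nth x (x :: rcons R y) 3) (b :: c).
  rewrite /pth /= rcons_path pc hb ?hc //.
    by apply: (@mem_nth_interior R 3 x).
  by apply: (@mem_nth_interior R 1 x); move: R3; clear; lia.
have /= sz := @size_splice V R (b :: c) 1 3 isT (leqW R3).
exists (take 1 R ++ (b :: c) ++ drop 2 R); last by rewrite size_cat /= size_cat; move: sz;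
  rewrite !size_cat /= size_cat; clear; lia.
split; first exact: (@pth_splice V t x y R 1 3 _ pR isT (leqW R3)).
  exact: (@uniq_splice V R (b :: c) 1 3).
by move=> z /(@mem_splice V R (b :: c) 1 3) /sD.
Qed.

(** This tells whether a chain inserted into paths with inner vertices [s] may begin with [n];
    [end_ok] tells whether it may stop there. *)
Definition start_ok (s : seq V) n := t x n || has (fun z => t z n) s.
Definition end_ok (s : seq V) n := t n y || has (t n) s.

Lemma start_okN s n : n \in Dxy -> n \notin s -> ~~ start_ok s n ->
  t n x /\ {in s, forall z, t n z}.
Proof.
move=> nD ns; rewrite negb_or => /andP[h /hasPn h']; split.
  by apply: (tourN tT) h; move: nD; rewrite !inE negb_or eq_sym; case/andP=> /andP[].
move=> z zs; apply: (tourN tT) (h' z zs).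
by apply: contraNneq ns => <-.
Qed.

Lemma end_okN s n : n \in Dxy -> n \notin s -> ~~ end_ok s n ->
  t y n /\ {in s, forall z, t z n}.
Proof.
move=> nD ns; rewrite negb_or => /andP[h /hasPn h']; split.
  by apply: (tourN tT) h; move: nD; rewrite !inE negb_or; case/andP=> /andP[].
move=> z zs; apply: (tourN tT) (h' z zs).
by apply: contraNneq ns => ->.
Qed.

Lemma absorb_free s c a b : linked t x y s -> path t a c -> last a c = b ->
  uniq (s ++ a :: c) -> t x a -> end_ok s b -> linked t x y (s ++ a :: c).
Proof.
move=> Ls pc lc u xa /orP[by_|/hasP[z zs bz]].
  apply: linked_merge => //; exists (a :: c) => //.
  by rewrite /pth /= xa rcons_path pc lc.
apply: (linked_head tT Ls zs) => //; exists (a :: c) => //.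
by rewrite /pth /= xa rcons_path pc lc.
Qed.

Lemma absorb_free_end s c a b : linked t x y s -> path t a c -> last a c = b ->
  uniq (s ++ a :: c) -> start_ok s a -> t b y -> linked t x y (s ++ a :: c).
Proof.
move=> Ls pc lc u /orP[xa|/hasP[z zs za]] by_.
  by apply: (absorb_free Ls pc lc) => //; rewrite /end_ok by_.
apply: (linked_tail tT Ls zs) => //; exists (a :: c) => //.
by rewrite /pth /= za rcons_path pc lc.
Qed.

Lemma absorb_cross p q c a b z z' : linked t x y p -> linked t x y q ->
  z \in p -> z' \in q -> t z a -> t b z' -> path t a c -> last a c = b ->
  uniq (p ++ q ++ a :: c) -> linked t x y (p ++ q ++ a :: c).
Proof.
move=> Lp Lq zp zq za bz pc lc u; apply: (linked_cross tT Lp Lq zp zq) => //.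
by exists (a :: c) => //; rewrite /pth /= za rcons_path pc lc.
Qed.

(** If neither [x] nor [y] helps, [n] has an inneighbour and an outneighbour among the inner
    vertices. If both lie on one path, any vertex of the other path can replace one of them,
    according to its arc with [n]; so [n] always crosses between the paths. *)
Lemma absorb_vertex2 p q n : linked t x y p -> linked t x y q -> p != [::] -> q != [::] ->
  uniq (p ++ q ++ [:: n]) -> start_ok (p ++ q) n -> end_ok (p ++ q) n ->
  linked t x y (p ++ q ++ [:: n]).
Proof.
move=> Lp Lq p0 q0 u sn en.
have u' : uniq ((p ++ q) ++ [:: n]) by rewrite -catA.
have upq : uniq (p ++ q) by move: u'; rewrite cat_uniq => /and3P[].
have Ls := linked_merge tT Lp Lq upq.
have [xn|xn] := boolP (t x n).
  by rewrite catA; apply: (@absorb_free _ [::] n n).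
have [ny|ny] := boolP (t n y).
  by rewrite catA; apply: (@absorb_free_end _ [::] n n).
move: sn en; rewrite /start_ok /end_ok (negbTE xn) (negbTE ny) /= !has_cat.
have sw : perm_eq (q ++ p ++ [:: n]) (p ++ q ++ [:: n]).
  by rewrite !catA perm_cat2r perm_catC.
have pqn z : z \in p ++ q -> t n z = ~~ t z n.
  move=> zs; apply: (proj2 tT); apply: contraTneq zs => <-.
  by move: u'; rewrite cat_uniq /= orbF => /and3P[].
have A1 z z' : z \in p -> z' \in q -> t z n -> t n z' -> linked t x y (p ++ q ++ [:: n]).
  by move=> zp zq zn nz; apply: (@absorb_cross p q [::] n n z z').
have A2 z z' : z \in q -> z' \in p -> t z n -> t n z' -> linked t x y (p ++ q ++ [:: n]).
  move=> zp zq zn nz; apply: (linked_perm sw).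
  by apply: (@absorb_cross q p [::] n n z z') => //; rewrite (perm_uniq sw).
have [a ap] : exists a, a \in p by case: (p) p0 => // a ? _; exists a; rewrite mem_head.
have [b bq] : exists b, b \in q by case: (q) q0 => // b ? _; exists b; rewrite mem_head.
case/orP=> /hasP[z zp zn] /orP[]/hasP[z' zp' nz].
- have [bn|bn] := boolP (t b n); first exact: (A2 b z').
  by apply: (A1 z b) => //; rewrite pqn // mem_cat bq orbT.
- exact: (A1 z z').
- exact: (A2 z z').
- have [an|an] := boolP (t a n); first exact: (A1 a z').
  by apply: (A2 z a) => //; rewrite pqn // mem_cat ap.
Qed.

(* A vertex outside that cannot be absorbed dominates all inner vertices and [x],
   or is dominated by all of them and [y]. An arc [b -> a] from the second kind to
   the first yields [r_1 -> b -> a -> r_3], which gains one vertex while skipping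
   [r_2]; without such an arc one of the two kinds is closed, hence too large. *)
Lemma two_paths_grow (p q : seq V) : linked t x y p -> linked t x y q ->
  p != [::] -> q != [::] -> uniq (p ++ q) -> {subset p ++ q <= Dxy} ->
  d <= (size (p ++ q)).+1 -> size (p ++ q) + 3 <= #|D| ->
  has_inner t D x y (size (p ++ q)).+1.
Proof.
move=> Lp Lq p0 q0 u sD ds sm.
set s := p ++ q in u sD ds sm *.
have s3 : 3 <= size s by move: ds d4; clear; lia.
set N := [set v in Dxy | v \notin s].
have cN : #|N| + size s + 2 = #|D| := card_outside u sD.
have NsD n : n \in N -> uniq (s ++ [:: n]) /\ {subset s ++ [:: n] <= Dxy}.
  rewrite inE => /andP[nD ns]; split.
    by rewrite cat_uniq u /= orbF ns.
  by move=> z; rewrite mem_cat => /orP[/sD//|]; rewrite inE => /eqP->.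
have [/exists_inP[n nN /andP[sn en]]|/exists_inPn noG] :=
    boolP [exists n in N, start_ok s n && end_ok s n].
  have [un Dn] := NsD n nN.
  have -> : (size s).+1 = size (s ++ [:: n]) by rewrite size_cat addn1.
  apply: linked_has_inner => //; rewrite -catA; apply: absorb_vertex2 => //.
  by rewrite catA.
pose A := [set n in N | ~~ start_ok s n]; pose B := [set n in N | ~~ end_ok s n].
have NAB n : n \in N -> (n \in A) || (n \in B).
  by move=> nN; have := noG n nN; rewrite negb_and [n \in A]inE [n \in B]inE nN.
have restP n : n \in N -> n \in Dxy /\ n \notin s by rewrite [n \in N]inE => /andP[].
have AN n : n \in A -> n \in N by rewrite [n \in A]inE => /andP[].
have BN n : n \in B -> n \in N by rewrite [n \in B]inE => /andP[].
have rest_sub n : n \in N -> n \in D by case/restP; rewrite [n \in Dxy]in_setD => /andP[].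
have inA n : n \in A -> t n x /\ {in s, forall z, t n z}.
  by rewrite [n \in A]inE => /andP[/restP[nD ns] h]; apply: start_okN.
have inB n : n \in B -> t y n /\ {in s, forall z, t z n}.
  by rewrite [n \in B]inE => /andP[/restP[nD ns] h]; apply: end_okN.
have [R pR eR] := linked_merge tT Lp Lq u.
have szR : size R = size s by apply: perm_size.
have [/existsP[b /existsP[a /and3P[bB aA ba]]]|noarc] :=
    boolP [exists b, exists a, [&& b \in B, a \in A & t b a]].
  have -> : (size s).+1 = size R + size [:: a] by rewrite szR addn1.
  have [bD bs] := restP b (BN b bB).
  have [aD as_] := restP a (AN a aA).
  apply: (@insert_dropping_one R b [:: a]) => //=.
  - by rewrite szR.
  - by rewrite ba.
  - by move=> z; rewrite (perm_mem eR); apply: (proj2 (inB b bB)).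
  - by move=> z; rewrite (perm_mem eR); apply: (proj2 (inA a aA)).
  - rewrite (@perm_uniq _ _ (s ++ [:: b; a])) ?perm_cat2r // cat_uniq u /= !inE.
    by rewrite (tour_neq tT ba) /= orbF andbT negb_or bs as_.
  by move=> z; rewrite mem_cat (perm_mem eR) => /orP[/sD//|]; rewrite mem_seq2 => /orP[]/eqP->.
exfalso.
have AB n : n \in A -> n \notin B.
  move=> nA; apply/negP=> nB; have [z zs] : exists z, z \in s.
    by rewrite /s; case: (p) p0 => // z ? _; exists z; rewrite mem_head.
  by have := tourF tT (proj2 (inA n nA) z zs); rewrite (proj2 (inB n nB) z zs).
have N0 : N != set0 by rewrite -card_gt0; move: cN sm; clear; lia.
have AD : A \subset D by apply/subsetP=> z /AN/rest_sub.
have BD : B \subset D by apply/subsetP=> z /BN/rest_sub.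
have sub C : (C == A) || (C == B) -> #|C| <= #|N|.
  by case/orP=> /eqP->; apply/subset_leq_card/subsetP=> z; [apply: AN|apply: BN].
have DN w : w \in D -> [|| w == x, w == y, w \in s | w \in N].
  by move=> wD; rewrite !inE wD; do 2!case: (w == _) => //=; case: (w \in s).
(* Now the inneighbours of [A] lie in [A] or equal [y], so a nonempty [A] has at least [2 d - 1]
   vertices. But [size s >= d - 1] and [#|D| <= 3 d - 1] leave only [2 d - 2] for [N]. If [A] is
   empty, the same count applies to [B = N]. *)
have [A0|A0] := eqVneq A set0; last first.
  have h := @closed_in V t D d A [set y] tT md AD A0.
  have hA := sub A; rewrite eqxx /= in hA; have {}hA := hA isT.
  suff : 2 * d + 1 <= #|A| + 2 * #|[set y]| by rewrite cards1; move: hA cN ds mD; clear; lia.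
  apply: h => v w vA wD wv; rewrite in_set1.
  have [vx vs] := inA v vA.
  case/or4P: (DN w wD) => [/eqP ew|->|ws|wN]; rewrite ?orbT //.
  - by move: (tourF tT vx); rewrite -ew wv.
  - by move: (tourF tT (vs w ws)); rewrite wv.
  - case/orP: (NAB w wN) => [->//|wB]; case/negP: noarc.
    by apply/existsP; exists w; apply/existsP; exists v; rewrite wB vA.
have NB : B = N.
  apply/setP=> n; apply/idP/idP=> [|nN]; first exact: BN.
  by have := NAB n nN; rewrite A0 inE.
have h := @closed_out V t D d B [set x] tT md BD.
rewrite NB in h; have {}h := h N0.
suff : 2 * d + 1 <= #|N| + 2 * #|[set x]| by rewrite cards1; move: cN ds mD; clear; lia.
apply: h => v w; rewrite -NB => vB wD vw; rewrite in_set1.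
have [vx vs] := inB v vB.
case/or4P: (DN w wD) => [->|/eqP ew|ws|wN]; rewrite ?orbT //.
- by move: (tourF tT vx); rewrite -ew vw.
- by move: (tourF tT (vs w ws)); rewrite vw.
- by rewrite NB wN.
Qed.

End TwoPaths.

(** * Vertices outside a path *)

(** Lists of fixed length form a finite type, so paths can be sought by contradiction without
    classical axioms. *)
Lemma has_inner_dec (V : finType) (t : rel V) (D : {set V}) (x y : V) k :
  has_inner t D x y k \/ ~ has_inner t D x y k.
Proof.
pose b := [exists p : k.-tuple V,
  [&& pth t x y p, uniq p & all [in D :\: [set x; y]] p]].
have [/existsP[p /and3P[pp up /allP sp]]|nb] := boolP b.
  by left; exists p; rewrite ?size_tuple.
right=> -[p [pp up sp] szp]; case/existsP: nb.
by exists (tcast szp (in_tuple p)); rewrite !val_tcast /= pp up; apply/allP.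
Qed.

(** The successor map sends the [Q]-vertices other than the last vertex injectively to vertices
    outside [R]. *)
Lemma count_shift (V : eqType) (Q R : pred V) h p :
  path (fun a b => ~~ (Q a && R b)) h p ->
  count Q (belast h p) <= count (predC R) p.
Proof.
elim: p h => //= a p IH h /andP[hQ /IH]; move: hQ.
by case: (Q h); case: (R a) => //= _; lia.
Qed.

Lemma sum_seq_set (V : finType) (s : seq V) (f : V -> nat) : uniq s ->
  \sum_(v in [set v in s]) f v = \sum_(v <- s) f v.
Proof. by move=> us; rewrite big_uniq //; apply: eq_bigl => v; rewrite inE. Qed.

Lemma sum_count (V : eqType) (s : seq V) (Q : pred V) :
  \sum_(v <- s) (Q v : nat) = count Q s.
Proof. by elim: s => [|a s IH]; rewrite ?big_nil // big_cons IH. Qed.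

Section Growth.
Variables (V : finType) (t : rel V) (D : {set V}) (d : nat) (x y : V).
Hypotheses (tT : tournament t) (md : mindeg t D d) (d4 : 4 <= d).
Hypotheses (mD : #|D| + 1 <= 3 * d) (xD : x \in D) (yD : y \in D) (xy : x != y).
Variables (p : seq V).
Hypotheses (ip : inner_path t D x y p) (p2 : 2 <= size p) (pm : size p + 3 <= #|D|).
Hypothesis nogrow : ~ has_inner t D x y (size p).+1.
Let Dxy := D :\: [set x; y].
Let W := [set u in Dxy | u \notin p].
Let v i := nth x (x :: rcons p y) i.

Let pp : pth t x y p. Proof. by case: ip. Qed.
Let up : uniq p. Proof. by case: ip. Qed.
Let pD : {subset p <= Dxy}. Proof. by case: ip. Qed.

Lemma outsideP u : u \in W -> [/\ u \in D, u != x, u != y & u \notin p].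
Proof.
by rewrite !inE negb_or -!andbA => /and4P[-> -> -> ->].
Qed.

Lemma outsideI u : u \in D -> u != x -> u != y -> u \notin p -> u \in W.
Proof. by rewrite !inE negb_or -!andbA => -> -> -> ->. Qed.

Lemma card_outside_path : #|W| + size p + 2 = #|D|.
Proof. exact: (card_outside xD yD xy up pD). Qed.

Lemma v0 : v 0 = x. Proof. by []. Qed.

Lemma v_last : v (size p).+1 = y.
Proof. by rewrite /v /= nth_rcons ltnn eqxx. Qed.

Lemma v_neq u i : u \in W -> i <= (size p).+1 -> u != v i.
Proof.
case/outsideP=> _ ux uy up' iP; apply/eqP=> e.
have : u \in x :: rcons p y by rewrite e mem_nth //= size_rcons.
by rewrite inE mem_rcons inE (negbTE ux) (negbTE uy) (negbTE up').
Qed.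

(** Only [j - i - 1] vertices lie strictly between the two positions, so the replacement would gain
    exactly one. *)
Lemma no_splice i j (c : seq V) : i < j -> j <= (size p).+1 -> uniq c -> {subset c <= W} ->
  size c = j - i -> pth t (v i) (v j) c -> False.
Proof.
move=> ij jp uc cW sc pc; apply: nogrow.
have sz := @size_splice V p c i j ij jp.
exists (take i p ++ c ++ drop j.-1 p); last by move: sz sc ij; clear; lia.
split; first exact: pth_splice.
  apply: uniq_splice => //; rewrite cat_uniq up uc andbT /=.
  by apply/hasPn=> z /cW /outsideP[].
move=> z /mem_splice; rewrite mem_cat => /orP[/pD//|/cW /outsideP[zD zx zy _]].
by rewrite !inE negb_or zD zx zy.
Qed.

(** The value is [(size p).+2] if [u] dominates the whole path, [x] and [y] included. *)
Definition threshold u := find (fun z => ~~ t u z) (x :: rcons p y).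

(** If [u] failed to dominate a vertex of the path but dominated the next one, it could be inserted
    between them. *)
Lemma thresholdP u i : u \in W -> i <= (size p).+1 -> t u (v i) = (i < threshold u).
Proof.
move=> uW iP; case: (ltnP i (threshold u)) => [ik|].
  by have /negbFE := before_find x ik.
elim: i iP => [|i IH] iP ki.
  have : ~~ t u (v (threshold u)).
    apply: (@nth_find _ x (fun z => ~~ t u z) (x :: rcons p y)).
    by rewrite has_find -/(threshold u) (leq_ltn_trans ki) /= ?size_rcons.
  by move: ki; rewrite leqn0 => /eqP->; apply: negbTE.
move: ki; rewrite leq_eqVlt => /orP[/eqP ki|ki].
  rewrite -ki; apply/negbTE.
  apply: (@nth_find _ x (fun z => ~~ t u z) (x :: rcons p y)).
  by rewrite has_find -/(threshold u) ki /= size_rcons.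
have tui := IH (ltnW iP) ki.
have viu : t (v i) u by apply: (tourN tT); rewrite ?tui // v_neq // ltnW.
apply/negP=> tuv; apply: (@no_splice i i.+1 [:: u]) => //.
- by move=> z; rewrite inE => /eqP->.
- by rewrite subSnn.
by rewrite /pth /= viu tuv.
Qed.

Lemma thresholdP_in u i : u \in W -> i <= (size p).+1 -> t (v i) u = (threshold u <= i).
Proof.
move=> uW iP; rewrite leqNgt -(thresholdP uW iP); apply: (proj2 tT).
by rewrite eq_sym v_neq.
Qed.

Lemma threshold_x u : u \in W -> t x u = (threshold u == 0).
Proof. by move=> uW; rewrite -v0 thresholdP_in // leqn0. Qed.

Lemma threshold_y u : u \in W -> t u y = (threshold u == (size p).+2).
Proof.
move=> uW; rewrite -v_last thresholdP // eqn_leq.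
suff -> : threshold u <= (size p).+2 by [].
by apply: leq_trans (find_size _ _) _; rewrite /= size_rcons.
Qed.

Lemma path_cases w : w \in D -> [\/ w = x, w = y, w \in p | w \in W].
Proof.
move=> wD; have [->|wx] := eqVneq w x; first by constructor 1.
have [->|wy] := eqVneq w y; first by constructor 2.
have [wp|wp] := boolP (w \in p); first by constructor 3.
by constructor 4; apply: outsideI.
Qed.

Lemma mem_path_nth w : w \in p -> exists2 i, i <= (size p).+1 & w = v i.
Proof.
move=> wp; exists (index w p).+1; first by rewrite ltnS index_size.
by rewrite /v /= nth_rcons index_mem wp nth_index.
Qed.

Lemma forall_path (Q : V -> Prop) : (forall i, i <= (size p).+1 -> Q (v i)) ->
  [/\ Q x, Q y & forall z, z \in p -> Q z].
Proof.
move=> h; split; [exact: (h 0)|by rewrite -v_last; apply: h|].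
by move=> z /mem_path_nth[i iP ->]; apply: h.
Qed.

(** The threshold of [u] is [0], so the whole path dominates [u]. *)
Lemma x_dom_all u : u \in W -> t x u -> forall w, w \in D -> t u w -> w \in W.
Proof.
move=> uW xu w wD uw; move: xu; rewrite threshold_x // => /eqP k0.
have [h1 h2 h3] : [/\ t u x = false, t u y = false & forall z, z \in p -> t u z = false].
  by apply: (@forall_path (fun z => t u z = false)) => i iP; rewrite thresholdP // k0.
by case: (path_cases wD) uw => [->|->|/h3->|//]; rewrite ?h1 ?h2.
Qed.

Lemma y_dom_all u : u \in W -> t u y -> forall w, w \in D -> t w u -> w \in W.
Proof.
move=> uW uy w wD wu; move: uy; rewrite threshold_y // => /eqP k0.
have [h1 h2 h3] : [/\ t x u = false, t y u = false & forall z, z \in p -> t z u = false].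
  by apply: (@forall_path (fun z => t z u = false)) => i iP;
    rewrite thresholdP_in // k0 leqNgt ltnS iP.
by case: (path_cases wD) wu => [->|->|/h3->|//]; rewrite ?h1 ?h2.
Qed.

Let Wx := [set w in W | t x w].
Let Wy := [set w in W | t w y].

Lemma outside_sub : W \subset D.
Proof. by apply/subsetP=> w /outsideP[]. Qed.

(** All outneighbours of [Wx] lie in [U], so [closed_out] applies to [Wx] with the exceptional set
    [U :\: Wx]. *)
Lemma card_nbhd_x (U : {set V}) : Wx != set0 -> Wx \subset U ->
  (forall u w, u \in Wx -> w \in W -> t u w -> w \in U) -> 2 * d + #|Wx| + 1 <= 2 * #|U|.
Proof.
move=> W0 WU h.
have H : 2 * d + 1 <= #|Wx| + 2 * #|U :\: Wx|.
  apply: (closed_out tT md _ W0).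
    by apply: subset_trans outside_sub; apply/subsetP=> w; rewrite inE => /andP[].
  move=> u w uWx wD uw; have [uW xu] : u \in W /\ t x u by move: uWx; rewrite inE => /andP.
  have wW := x_dom_all uW xu wD uw.
  by rewrite in_setD (h u w uWx wW uw) andbT orbN.
have := cardsID Wx U; rewrite (setIidPr WU); move: H; clear; lia.
Qed.

Lemma card_nbhd_y (U : {set V}) : Wy != set0 -> Wy \subset U ->
  (forall u w, u \in Wy -> w \in W -> t w u -> w \in U) -> 2 * d + #|Wy| + 1 <= 2 * #|U|.
Proof.
move=> W0 WU h.
have H : 2 * d + 1 <= #|Wy| + 2 * #|U :\: Wy|.
  apply: (closed_in tT md _ W0).
    by apply: subset_trans outside_sub; apply/subsetP=> w; rewrite inE => /andP[].
  move=> u w uWx wD uw; have [uW xu] : u \in W /\ t u y by move: uWx; rewrite inE => /andP.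
  have wW := y_dom_all uW xu wD uw.
  by rewrite in_setD (h u w uWx wW uw) andbT orbN.
have := cardsID Wy U; rewrite (setIidPr WU); move: H; clear; lia.
Qed.

Lemma card_X : d <= #|Wx| + count (t x) p + 1.
Proof. exact: (count_out_x tT md xD up pD). Qed.

Lemma card_Y : d <= #|Wy| + count (fun z => t z y) p + 1.
Proof. exact: (count_in_y tT md yD up pD). Qed.

Lemma in_Wx u : (u \in Wx) = (u \in W) && t x u.
Proof. by rewrite inE. Qed.
Lemma in_Wy u : (u \in Wy) = (u \in W) && t u y.
Proof. by rewrite inE. Qed.

(** Otherwise [x -> u -> w -> v 2] would replace [v 1] by two vertices. *)
Lemma Wx_succ u w : u \in Wx -> w \in W -> t u w -> threshold w <= 2.
Proof.
rewrite in_Wx => /andP[uW xu] wW uw; rewrite leqNgt; apply/negP=> h.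
apply: (@no_splice 0 2 [:: u; w]) => //=.
- by move: p2; clear; lia.
- by rewrite inE (tour_neq tT uw).
- by move=> z; rewrite mem_seq2 => /orP[]/eqP->.
- rewrite /pth; change (path t x [:: u; w; v 2]).
  by rewrite /= xu uw thresholdP ?h //; move: p2; clear; lia.
Qed.

Lemma Wy_pred u w : u \in Wy -> w \in W -> t w u -> size p <= threshold w.
Proof.
rewrite in_Wy => /andP[uW uy] wW wu; rewrite leqNgt; apply/negP=> h.
apply: (@no_splice (size p).-1 (size p).+1 [:: w; u]) => //=.
- by move: p2; clear; lia.
- by rewrite inE (tour_neq tT wu).
- by move=> z; rewrite mem_seq2 => /orP[]/eqP->.
- by move: p2; clear; lia.
- rewrite /pth; change (path t (v (size p).-1) [:: w; u; v (size p).+1]).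
  have i1 : (size p).-1 <= (size p).+1 by clear; lia.
  rewrite [path _ _ _]/= v_last uy wu (thresholdP_in wW i1) !andbT.
  by move: p2 h; clear; lia.
Qed.

(** [U1] extends [Wx] by its outneighbours in [W] and has thresholds at most [2]; [U2] extends [Wy]
    by its inneighbours and has thresholds at least [size p]. Both are large by the preceding
    counts, and if disjoint they do not fit into [W]. *)
Lemma grow_both_outside : Wx != set0 -> Wy != set0 -> False.
Proof.
move=> x0 y0.
pose U1 := Wx :|: [set w in W | [exists u in Wx, t u w]].
pose U2 := Wy :|: [set w in W | [exists u in Wy, t w u]].
have h1 : 2 * d + #|Wx| + 1 <= 2 * #|U1|.
  apply: card_nbhd_x => //; first exact: subsetUl.
  move=> u w uW wW uw; rewrite in_setU [w \in [set _ in _ | _]]inE wW /=; apply/orP; right.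
  by apply/exists_inP; exists u.
have h2 : 2 * d + #|Wy| + 1 <= 2 * #|U2|.
  apply: card_nbhd_y => //; first exact: subsetUl.
  move=> u w uW wW uw; rewrite in_setU [w \in [set _ in _ | _]]inE wW /=; apply/orP; right.
  by apply/exists_inP; exists u.
have U1W w : w \in U1 -> w \in W /\ (t x w \/ exists2 u, u \in Wx & t u w).
  rewrite in_setU in_Wx => /orP[/andP[-> ->]|]; first by split=> //; left.
  rewrite [w \in [set _ in _ | _]]inE => /andP[-> /exists_inP[u uW uw]]; split=> //.
  by right; exists u.
have U2W w : w \in U2 -> w \in W /\ (t w y \/ exists2 u, u \in Wy & t w u).
  rewrite in_setU in_Wy => /orP[/andP[-> ->]|]; first by split=> //; left.
  rewrite [w \in [set _ in _ | _]]inE => /andP[-> /exists_inP[u uW uw]]; split=> //.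
  by right; exists u.
have dis : [disjoint U1 & U2].
  apply/pred0P=> w /=; apply/negP=> /andP[/U1W[wW c1] /U2W[_ c2]].
  have k1 : threshold w <= 2.
    by case: c1 => [|[u uW uw]]; [rewrite threshold_x // => /eqP->|apply: (Wx_succ uW wW uw)].
  have k2 : size p <= threshold w.
    case: c2 => [|[u uW uw]]; [rewrite threshold_y // => /eqP->|exact: (Wy_pred uW wW uw)].
    by clear; lia.
  (* The threshold ranges meet only for [size p = 2]. A common vertex [w] then gives the path
     [x -> u -> w -> u' -> y], which is longer by one. *)
  have sz2 : size p = 2 by move: k1 k2 p2; clear; lia.
  case: c1 => [|[u uW uw]].
    by rewrite threshold_x // => /eqP k; move: k2 p2; rewrite k; clear; lia.
  case: c2 => [|[u' uW' uw']].
    by rewrite threshold_y // => /eqP k; move: k1; rewrite k sz2.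
  move: uW uW'; rewrite in_Wx in_Wy => /andP[uW xu] /andP[uW' uy].
  apply: (@no_splice 0 3 [:: u; w; u']) => //=.
  - rewrite !inE negb_or (tour_neq tT uw) (tour_neq tT uw') /= andbT.
    apply: contraTneq xu => ->; rewrite threshold_x //.
    by move: uy; rewrite threshold_y // => /eqP->.
  - by move=> z; rewrite in_cons mem_seq2 => /orP[/eqP->|/orP[]/eqP->].
  - rewrite /pth; change (path t x [:: u; w; u'; v 3]).
    by rewrite /= xu uw uw' -sz2 v_last uy.
have h3 : #|U1| + #|U2| <= #|W|.
  rewrite -cardsUI (disjoint_setI0 dis) cards0 addn0.
  by apply/subset_leq_card/subsetP=> w; rewrite in_setU => /orP[/U1W[]|/U2W[]].
have := card_outside_path; have := card_X; have := card_Y.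
have := count_size (t x) p; have := count_size (fun z => t z y) p.
move: h1 h2 h3 mD; clear; lia.
Qed.

Hypothesis dp : d <= (size p).+1.

(** The two arcs turn [p1] and [p2'] into disjoint [(x,y)]-paths, and [two_paths_grow] applies to
    them. *)
Lemma no_YX_step p1 p2' : p = p1 ++ p2' -> p1 != [::] -> p2' != [::] ->
  t (last x p1) y -> t x (head y p2') -> False.
Proof.
move=> e n1 n2 h1 h2; apply: nogrow.
have pp' := pp; have up' := up; have pD' := pD; have dp' := dp; have pm' := pm;
  rewrite e in pp' up' pD' dp' pm' *.
apply: (two_paths_grow tT md d4 mD xD yD xy) => //.
  exists p1 => //; rewrite /pth rcons_path h1 andbT.
  by move: pp'; rewrite /pth rcons_cat cat_path => /andP[].
exists p2' => //; case: (p2') n2 h2 pp' => // z q _ /= xz.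
by rewrite /pth rcons_cat cat_path /= xz => /and3P[].
Qed.

Lemma p_cons : exists h p', p = h :: p'.
Proof. by case: (p) p2 => // h p' _; exists h, p'. Qed.

Lemma no_YX h p' : p = h :: p' -> path (fun a b => ~~ (t a y && t x b)) h p'.
Proof.
move=> e; apply/(pathP h)=> i ip'; apply/negP=> /andP[h1 h2].
apply: (@no_YX_step (take i.+1 p) (drop i.+1 p)); rewrite ?cat_take_drop //.
- by rewrite -size_eq0 size_takel // e /=; move: ip'; clear; lia.
- by rewrite -size_eq0 size_drop e /=; move: ip'; clear; lia.
- rewrite -nth_last size_takel; last by rewrite e /=; move: ip'; clear; lia.
  rewrite nth_take // e /= (set_nth_default h) //=; move: ip'; clear; lia.
- by rewrite e /= (drop_nth h).
Qed.

Lemma count_Y_X : count (t x) p + count (fun z =>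
  t z y) (belast (head x p) (behead p)) <= size p.
Proof.
have [h [p' e]] := p_cons; have := count_shift (no_YX e); rewrite e /=.
have := count_predC (t x) p'; have := leq_b1 (t x h); clear; lia.
Qed.

(* The vertices that precede a missed inneighbour of [y] dominate all but the last
   inner vertex of [p], which leaves those inner vertices too few outneighbours. *)
Lemma grow_y_outside : Wx = set0 -> Wy != set0 -> False.
Proof.
move=> x0 y0; have [h [p' e]] := p_cons.
pose s := belast h p'.
have ep : p = rcons s (last h p') by rewrite e lastI.
have us : uniq s by move: up; rewrite ep rcons_uniq => /andP[].
have szs : size s = size p' by rewrite size_belast.
pose J := [set z in s]; pose U := [set w in W | size p <= threshold w].
have cJ : #|J| = size p' by rewrite cardsE (card_uniqP us).
have cU : 2 * d + #|Wy| + 1 <= 2 * #|U|.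
  apply: card_nbhd_y => //.
    apply/subsetP=> w; rewrite in_Wy [w \in U]inE => /andP[wW];
      rewrite wW threshold_y // => /eqP->.
    by clear; lia.
  by move=> u w uW wW wu; rewrite [w \in U]inE wW (Wy_pred uW).
have sv z : z \in s -> exists2 i, 0 < i < size p & z = v i.
  move=> zs; exists (index z s).+1; first by rewrite e /= ltnS -szs index_mem.
  by rewrite /v /= ep nth_rcons size_rcons ltnS index_size nth_rcons index_mem zs nth_index.
have JU z u : z \in s -> u \in U -> t u z.
  move=> /sv[i /andP[_ ip'] ->]; rewrite [u \in U]inE => /andP[uW ku].
  rewrite thresholdP //; last by move: ip'; clear; lia.
  exact: leq_trans ip' ku.
have sp z : z \in s -> z \in p by rewrite ep mem_rcons inE => ->; rewrite orbT.
pose w0 := #|W :\: U|.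
have main : 2 * (d * #|J|) <= #|J| * #|J|.-1
     + 2 * \sum_(z in J) ((1 + w0) + (~~ t x z : nat) + (t z y : nat)).
  apply: (sum_out_le tT) => z; rewrite inE => zs.
  have zD : z \in D by move: (pD (sp z zs)); rewrite inE => /andP[].
  apply: leq_trans (proj1 (md zD)) _.
  (* Outside [J], the vertex [z] can dominate the last inner vertex, [x], [y] and vertices of
     [W :\: U]; the vertices of [U] dominate [z]. *)
  pose F := ([set last h p'] :|: (W :\: U)) :|: (if t z x then [set x] else set0)
            :|: (if t z y then [set y] else set0).
  apply: leq_trans (outin_le (J := J) (F := F) _) _.
    move=> w wD zw; case: (path_cases wD) => [ew|ew|wp|wW].
    - by rewrite /F !in_setU -ew zw !in_set1 eqxx ?orbT.
    - by rewrite /F !in_setU -ew zw !in_set1 eqxx ?orbT.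
    - move: wp; rewrite ep mem_rcons inE => /orP[/eqP->|ws].
        by rewrite /F !in_setU in_set1 eqxx !orbT.
      by rewrite [w \in J]inE ws.
    - rewrite /F !in_setU in_setD wW andbT; case: (boolP (w \in U)) => [wU|]; rewrite ?orbT //.
      by move: (tourF tT (JU z w zs wU)); rewrite zw.
  rewrite leq_add2l.
  have l1 (S1 S2 : {set V}) := leq_card_setU S1 S2.
  have zx : (t z x : nat) <= (~~ t x z : nat).
    by case: (boolP (t z x)) => // zx; rewrite (tourF tT zx).
  apply: leq_trans (l1 _ _) _; apply: leq_add; last by case: (t z y); rewrite ?cards1 ?cards0.
  apply: leq_trans (l1 _ _) _; apply: leq_add; last by apply: leq_trans zx; case: (t z x);
    rewrite ?cards1 ?cards0.
  by apply: leq_trans (l1 _ _) _; rewrite cards1.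
move: main; rewrite sum_seq_set // !big_split /= !sum_count.
rewrite !big_const_seq !count_predT !iter_addn_0 cJ !szs.
have cX := card_X; rewrite x0 cards0 add0n in cX.
have a1 : count (fun z => ~~ t x z) s + count (t x) p <= size p.
  rewrite -[size p](count_predC (t x)) addnC leq_add2l ep -cats1 count_cat /=.
  exact: leq_addr.
have b1 := count_Y_X; rewrite (congr1 behead e) (congr1 (head x) e) [behead _]/= [head _
  _]/= -/s in b1.
have cY := card_Y; rewrite [in count _ p]ep -cats1 count_cat [count _ [:: _]]/= in cY.
have lb := leq_b1 (t (last h p') y).
have cW := card_outside_path; have := cardsID U W.
have -> : W :&: U = U by apply/setIidPr/subsetP=> w; rewrite [w \in U]inE => /andP[].
have szp : size p = (size p').+1 by rewrite e.
rewrite -/w0 => h1; move: cU cX a1 b1 cY lb cW h1 szp mD d4 p2.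
move: (count (t x) p) (count _ s) (count _ s) (size p) (size p') (w0) #|Wy| #|U| #|W| #|D|.
move: (nat_of_bool (t (last h p') y)).
clear => q cx a b sp sp' w Y U W m H1 H2 H3 H4 H5 H6 H7 H8 H9 H10 H11 H12 H13.
(* With [j = sp'] the degree sum reads [2 d j <= j^2 + j + 2 j w + 2 (a + b)]. By [k1] this forces
   [4 j <= 2 (a + b)], and [k2] turns it into [4 d <= 8]. *)
have k1 : 2 * w + sp + 4 <= 2 * d by lia.
have k2 : a + b + 2 * d <= 2 * sp + 2 by lia.
have k3 : sp' * (2 * w + sp' + 5) <= sp' * (2 * d) by rewrite leq_mul2l; lia.
have k5 : sp' * sp'.-1 = sp' * sp' - sp' by case: (sp') => // j; rewrite /= mulnS; lia.
have k4 : sp' <= sp' * sp' by case: (sp') => // j; rewrite mulnS; lia.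
lia.
Qed.

(** On the path [x] has at least [d - 1] outneighbours and [y] at least [d - 1] inneighbours. The
    successors of the latter, the last inner vertex excepted, are not among the former. *)
Lemma grow_none_outside : Wx = set0 -> Wy = set0 -> 2 * d <= size p + 3.
Proof.
move=> x0 y0; have [h [p' e]] := p_cons.
have cX := card_X; rewrite x0 cards0 add0n in cX.
have cY := card_Y; rewrite y0 cards0 add0n in cY.
have b1 := count_Y_X; rewrite (congr1 behead e) (congr1 (head x) e) [behead _]/= [head _
  _]/= in b1.
have ep : p = rcons (belast h p') (last h p') by rewrite e lastI.
rewrite ep -cats1 count_cat [count _ [:: _]]/= in cY.
have := leq_b1 (t (last h p') y); move: cX cY b1; clear; lia.
Qed.

End Growth.

(** * Two paths of intermediate total length *)

Section Interpolation.
Variables (V : finType) (t : rel V) (D : {set V}) (x y : V).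
Hypothesis tT : tournament t.
Variables (R c : seq V).
Hypotheses (pR : pth t x y R) (pc : pth t x y c).
Hypotheses (uRc : uniq (R ++ c)) (RcD : {subset R ++ c <= D :\: [set x; y]}).
Hypotheses (R0 : R != [::]).
Variables (e dl : nat).
Hypothesis sc : e + dl = size c.

Lemma pth_take z i : 0 < i <= size c -> t (nth x c i.-1) z -> pth t x z (take i c).
Proof.
move=> /andP[i0 ic] h; rewrite /pth rcons_path; apply/andP; split.
  by move: pc; rewrite /pth rcons_path -{1}(cat_take_drop i c) cat_path => /andP[/andP[]].
by rewrite -nth_last size_takel // nth_take ?prednK.
Qed.

Lemma pth_drop z i : i < size c -> t z (nth x c i) -> pth t z y (drop i c).
Proof.
move=> ic h; rewrite /pth (drop_nth x) //= h /=.
by move: pc; rewrite /pth -{1}(cat_take_drop i c) (drop_nth x) // rcons_cat cat_path /=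
  => /and3P[].
Qed.

Lemma uniq_sub s : subseq s c -> uniq (R ++ s) /\ {subset R ++ s <= D :\: [set x; y]}.
Proof.
move=> ss; have sRs : subseq (R ++ s) (R ++ c) by apply: cat_subseq.
by split; [apply: subseq_uniq uRc|move=> z /(mem_subseq sRs)/RcD].
Qed.

(** The prefix of [c] of length [i] returns to [R], the suffix of length [e - i] leaves from [R],
    and the [dl] vertices between them are omitted. For [i = 0] or [i = e] one piece is empty. *)
Lemma insert_prefix_suffix i : i <= e ->
  (i = 0 \/ exists2 z, z \in R & t (nth x c i.-1) z) ->
  (i = e \/ exists2 z, z \in R & t z (nth x c (i + dl))) ->
  has_inner t D x y (size R + e).
Proof.
move=> ie hi he.
have [u12 D12] : uniq (R ++ take i c ++ drop (i + dl) c) /\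
    {subset R ++ take i c ++ drop (i + dl) c <= D :\: [set x; y]}.
  apply: uniq_sub; rewrite -[X in subseq _ X](cat_take_drop i c); apply: cat_subseq => //.
  by rewrite addnC -drop_drop drop_subseq.
have [u1 D1] := uniq_sub (take_subseq c i).
have L1 : linked t x y (R ++ take i c).
  case: (posnP i) => [->|i0]; first by rewrite take0 cats0; apply: pth_linked.
  case: hi => [hi|[z zR h]]; first by rewrite hi in i0.
  apply: (linked_head tT (pth_linked pR) zR) => //; apply: pth_linked.
  by apply: pth_take; rewrite ?i0 -?sc //; move: ie; clear; lia.
have L2 : linked t x y (R ++ take i c ++ drop (i + dl) c).
  case: he => [ei|[z zR h]].
    by rewrite ei sc drop_size cats0 -ei.
  case: (ltnP (i + dl) (size c)) => [ic|ic]; last by rewrite drop_oversize // cats0.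
  rewrite catA; apply: (linked_tail tT L1 (z := z)); last by rewrite -catA.
    by rewrite mem_cat zR.
  by apply: pth_linked; apply: pth_drop.
have <- : size (R ++ take i c ++ drop (i + dl) c) = size R + e.
  rewrite !size_cat size_takel ?size_drop -sc; move: ie; clear; lia.
exact: linked_has_inner.
Qed.

(** Here all of [c] is used and the last [dl] vertices of [R] are dropped instead;
    [insert_all_early] drops the first [dl]. *)
Lemma insert_all_late : dl <= size R -> 0 < size c -> {in R, forall z, t z (nth x c 0)} ->
  has_inner t D x y (size R + e).
Proof.
move=> dR c0 h; pose i := size R - dl.
have ij : i < (size R).+1 by rewrite ltnS leq_subr.
have sz := @size_splice V R c i _ ij (leqnn _).
exists (take i R ++ c ++ drop (size R) R).
  split; last first.
  - by move=> z /(@mem_splice V R c i (size R).+1)/RcD.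
  - exact: (@uniq_splice V R c i (size R).+1).
  apply: (@pth_splice V t x y R i (size R).+1 c pR ij (leqnn _)).
  have -> : nth x (x :: rcons R y) (size R).+1 = y by rewrite /= nth_rcons ltnn eqxx.
  case: (posnP i) => [->//|i0].
  rewrite -[c](drop0); apply: pth_drop => //; apply: h; apply: mem_nth_interior.
  by rewrite i0 leq_subr.
by move: sz sc dR; rewrite /i /=; clear; lia.
Qed.

Lemma insert_all_early : dl <= size R -> 0 < size c ->
  {in R, forall z, t (nth x c (size c).-1) z} -> has_inner t D x y (size R + e).
Proof.
move=> dR c0 h.
have jp : dl.+1 <= (size R).+1 by [].
have sz := @size_splice V R c 0 _ (ltn0Sn dl) jp.
exists (take 0 R ++ c ++ drop dl R).
  split; last first.
  - by move=> z /(@mem_splice V R c 0 dl.+1)/RcD.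
  - exact: (@uniq_splice V R c 0 dl.+1).
  apply: (@pth_splice V t x y R 0 dl.+1 c pR _ jp) => //.
  move: dR; rewrite leq_eqVlt => /orP[/eqP->|dR].
    by have -> : nth x (x :: rcons R y) (size R).+1 = y by rewrite /= nth_rcons ltnn eqxx.
  rewrite -[c](take_size); apply: pth_take; first by rewrite c0 leqnn.
  by apply: h; apply: mem_nth_interior.
by move: sz sc; rewrite /=; clear; lia.
Qed.

(* With [a i] and [b i] saying that the [i]-th vertex of [c] dominates, respectively is
   dominated by, the inner vertices of [R]: if no prefix of length [i] and suffix of
   length [e - i] fit, then [b (i - 1)] or [a (i + dl)], and these constraints propagate
   along the residue classes modulo [dl + 1] until they contradict each other. *)
Lemma interpolate : 0 < e -> 0 < dl ->
  (dl <= 2 /\ dl <= size R) \/ (dl = 3 /\ (e = 4 \/ (e <= 2 /\ 3 <= size R))) ->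
  has_inner t D x y (size R + e).
Proof.
move=> e0 dl0 hd; have [//|no] := has_inner_dec t D x y (size R + e); exfalso.
pose a i := all (t (nth x c i)) R; pose b i := all (fun z => t z (nth x c i)) R.
have c0 : 0 < size c by move: sc e0; clear; lia.
have Rc i z : i < size c -> z \in R -> z != nth x c i.
  move=> ic zR; apply: contraTneq uRc => ez; rewrite cat_uniq negb_and; apply/orP; right.
  rewrite negb_and negbK; apply/orP; left; apply/hasP; exists z => //.
  by rewrite ez mem_nth.
have ab i : a i -> b i = false.
  move=> /allP ai; apply/negP=> /allP bi.
  have [z zR] : exists z, z \in R by case: (R) R0 => // z ? _; exists z; rewrite mem_head.
  by have := tourF tT (ai z zR); rewrite bi.
have step i : i <= e -> (0 < i /\ b i.-1) \/ (i < e /\ a (i + dl)).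
  move=> ie; have [bi|bi] := boolP ((0 < i) && b i.-1); first by left; apply/andP.
  have [ai|ai] := boolP ((i < e) && a (i + dl)); first by right; apply/andP.
  exfalso; apply: no; apply: (@insert_prefix_suffix i) => //.
    move: bi; case: (posnP i) => [->|i0 /=]; first by left.
    case/allPn=> z zR nz; right; exists z => //; apply: (tourN tT) nz.
    by apply: Rc => //; rewrite -sc; move: ie i0; clear; lia.
  move: ie; rewrite leq_eqVlt => /orP[/eqP ->|ie]; first by left.
  move: ai; rewrite ie /= => /allPn[z zR nz]; right; exists z => //.
  apply: (tourN tT) nz; rewrite eq_sym; apply: Rc => //; rewrite -sc.
  by move: ie; clear; lia.
have a_dl : a dl by case: (step 0 (leq0n _)) => [[]|[_]].
have b_e : b e.-1 by case: (step e (leqnn _)) => [[]|[]] //; rewrite ltnn.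
have next j : j.+1 < e -> a j -> a (j.+1 + dl).
  by move=> je aj; case: (step j.+1 (ltnW je)) => [[_]|[]//]; rewrite /= ab.
have iterA k : k * dl.+1 < e -> a (dl + k * dl.+1).
  elim: k => [|k IH] ke; first by rewrite mul0n addn0.
  have -> : dl + k.+1 * dl.+1 = (dl + k * dl.+1).+1 + dl by rewrite mulSn; clear; lia.
  by apply: next; [move: ke|apply: IH; move: ke]; rewrite mulSn; clear; lia.
have nb0 : dl <= size R -> b 0 = false.
  move=> dR; apply/negP=> /allP b0; apply: no; exact: insert_all_late.
have na_last : dl <= size R -> a (size c).-1 = false.
  move=> dR; apply/negP=> /allP al; apply: no; exact: insert_all_early.
have iterB k : dl <= size R -> 1 + k * dl.+1 < e -> a (1 + dl + k * dl.+1).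
  move=> dR; elim: k => [|k IH] ke.
    rewrite mul0n addn0; case: (step 1 e0) => [[_]|[]//].
    by rewrite /= nb0.
  have -> : 1 + dl + k.+1 * dl.+1 = (1 + dl + k * dl.+1).+1 + dl by rewrite mulSn; clear; lia.
  by apply: next; [move: ke|apply: IH; move: ke]; rewrite mulSn; clear; lia.
have contraE k : ~~ (k * dl.+1 < e) || (dl + k * dl.+1 != e.-1).
  rewrite -negb_and; apply/negP=> /andP[/iterA h1 /eqP h2].
  by move: (ab _ h1); rewrite h2 b_e.
have contraE' k : dl <= size R -> 1 + k * dl.+1 < e -> 1 + dl + k * dl.+1 != e.-1.
  move=> dR /(iterB k dR) h1; apply/eqP=> h2.
  by move: (ab _ h1); rewrite h2 b_e.
have contraL k : dl <= size R -> 1 + k * dl.+1 < e -> 1 + dl + k * dl.+1 != (size c).-1.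
  by move=> dR /(iterB k dR) h1; apply/eqP=> h2; move: (na_last dR); rewrite -h2 h1.
have e1 : dl <= size R -> e != 1.
  by move=> dR; apply/eqP=> h; move: b_e; rewrite h /= nb0.
(* [contraE], [contraE'] and [contraL] deal with [e] congruent to [0], [1] and [2] modulo [dl + 1],
   which is everything for [dl <= 2]; the value [e = 1] is excluded by [e1]. *)
move: hd; case=> [[d2 dR]|[d3 [e4|[e2 dR]]]].
- have {}e1 := e1 dR; have {}contraE' k := contraE' k dR; have {}contraL k := contraL k dR.
  have [d1|{}d2] : dl = 1 \/ dl = 2 by move: d2 dl0; clear; lia.
    move: (contraE (e./2.-1)) (contraE' (e./2.-1)) e1; rewrite d1.
    by move: e0; clear; lia.
  move: (contraE (e %/ 3).-1) (contraE' (e %/ 3).-1) (contraL (e %/ 3)) e1 sc; rewrite d2.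
  by move: e0; clear; lia.
- by move: (contraE 0); rewrite d3 e4.
- move: (e1 (leq_trans (eq_leq d3) dR)) (contraL 0 (leq_trans (eq_leq d3) dR)) sc.
  by rewrite d3; move: e0 e2; clear; lia.
Qed.

End Interpolation.

(** * Hall's theorem *)

Section Hall.
Variables (L R : finType) (e : L -> R -> bool) (r0 : R).

Definition nbrs (A : {set L}) (B : {set R}) : {set R} :=
  [set r in B | [exists l in A, e l r]].

Lemma nbrsP (A : {set L}) (B : {set R}) r : reflect (r \in B /\ exists2 l, l \in A & e l
  r) (r \in nbrs A B).
Proof.
rewrite inE; apply: (iffP andP) => [[rB /exists_inP[l lA lr]]|[rB [l lA lr]]].
  by split=> //; exists l.
by split=> //; apply/exists_inP; exists l.
Qed.

(** Induction on [#|A|]. If a nonempty proper subset is tight, that is, has no more neighbours than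
    elements, it is matched first and its neighbours are removed from [B] for the rest; this is why
    [B] varies. *)
Lemma hall_in (A : {set L}) (B : {set R}) :
  (forall A' : {set L}, A' \subset A -> #|A'| <= #|nbrs A' B|) ->
  exists f : L -> R, {in A &, injective f} /\ {in A, forall l, e l (f l) && (f l \in B)}.
Proof.
have [n] := ubnP #|A|; elim: n A B => // n IH A B An cond.
have [A0|[l lA]] := set_0Vmem A.
  by exists (fun=> r0); split=> [l l'|l]; rewrite A0 inE.
have [/existsP[A' /and4P[A'A A'0 A'n tight]]|notight] := boolP
  [exists A' : {set L}, [&& A' \subset A, A' != set0, A' != A & #|nbrs A' B| <= #|A'|]].
  have pA' : A' \proper A by rewrite properEneq A'n.
  have [||f [fi fe]] := IH A' (nbrs A' B).
  - by apply: leq_trans (proper_card pA') _.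
  - move=> A'' s''; apply: leq_trans (cond A'' (subset_trans s'' A'A)) _.
    apply/subset_leq_card/subsetP=> r /nbrsP[rB [l' l'A le]].
    by apply/nbrsP; split; [apply/nbrsP; split=> //; exists l' => //;
      apply: (subsetP s'')|exists l'].
  have [||g [gi ge]] := IH (A :\: A') (B :\: nbrs A' B).
  - apply: leq_trans (_ : #|A :\: A'| < #|A|) An; apply: proper_card.
    rewrite properE subsetDl /=; have [l' l'A'] := set0Pn _ A'0.
    apply/subsetPn; exists l'; first exact: (subsetP A'A).
    by rewrite in_setD l'A'.
  - move=> A'' s''.
    have sA : A'' :|: A' \subset A.
      by rewrite subUset A'A andbT; apply: subset_trans s'' (subsetDl _ _).
    have dis : [disjoint A'' & A'].
      by apply: disjointWl s'' _; rewrite disjoints_subset setDE subsetIr.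
    have := cond _ sA; rewrite cardsU (disjoint_setI0 dis) cards0 subn0 => h.
    have : #|nbrs (A'' :|: A') B| <= #|nbrs A'' (B :\: nbrs A' B)| + #|nbrs A' B|.
      apply: leq_trans (leq_card_setU _ _); apply/subset_leq_card/subsetP=> r.
      case/nbrsP=> rB [l' l'A le]; rewrite in_setU.
      case: (boolP (r \in nbrs A' B)) => [|rn]; first by rewrite orbT.
      rewrite orbF; apply/nbrsP; split; first by rewrite in_setD rn.
      move: l'A; rewrite in_setU => /orP[l'A|l'A]; first by exists l'.
      by case/negP: rn; apply/nbrsP; split=> //; exists l'.
    by move: h tight; clear; lia.
  exists (fun l => if l \in A' then f l else g l); split.
    move=> l1 l2 l1A l2A; case: ifP => l1A'; case: ifP => l2A'.
    - exact: fi.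
    - have /andP[_ h1] := fe _ l1A'.
      have l2D : l2 \in A :\: A' by rewrite in_setD l2A'.
      have /andP[_] := ge l2 l2D; rewrite in_setD => /andP[h2 _] h.
      by move: h2; rewrite -h h1.
    - have /andP[_ h1] := fe _ l2A'.
      have l1D : l1 \in A :\: A' by rewrite in_setD l1A'.
      have /andP[_] := ge l1 l1D; rewrite in_setD => /andP[h2 _] h.
      by move: h2; rewrite h h1.
    - by apply: gi; rewrite in_setD ?l1A' ?l2A'.
  move=> l1 l1A; case: ifP => l1A'.
    by have /andP[-> /nbrsP[]] := fe _ l1A'.
  have l1D : l1 \in A :\: A' by rewrite in_setD l1A'.
  have /andP[->] := ge l1 l1D.
  by rewrite in_setD => /andP[].
(* No nonempty proper subset is tight, so the condition survives the removal of any single matched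
   pair. *)
have := cond [set l]; rewrite sub1set => /(_ lA); rewrite cards1 card_gt0.
case/set0Pn=> r /nbrsP[rB [l']]; rewrite inE => /eqP-> lr.
have [||f [fi fe]] := IH (A :\ l) (B :\ r).
- by move: An; rewrite (cardsD1 l A) lA.
- move=> A' sA'; have [->|A'0] := eqVneq A' set0; first by rewrite cards0.
  have sA'A : A' \subset A by apply: subset_trans sA' (subsetDl _ _).
  have lA' : l \notin A'.
    by apply/negP=> h; have := subsetP sA' l h; rewrite !inE eqxx.
  have : #|A'| < #|nbrs A' B|.
    rewrite ltnNge; apply: contra notight => h; apply/existsP; exists A'.
    rewrite sA'A A'0 h andbT /=; apply: contraNneq lA' => ->; exact: lA.
  have -> : nbrs A' (B :\ r) = nbrs A' B :\ r.
    by apply/setP=> s; rewrite !inE andbA.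
  by rewrite (cardsD1 r (nbrs A' B)); case: (r \in _); rewrite ?add1n ?add0n //; apply: ltnW.
exists (fun k => if k == l then r else f k); split.
  move=> l1 l2 l1A l2A; case: eqP => [->|/eqP n1]; case: eqP => [->//|/eqP n2].
  - move=> h; have l2D : l2 \in A :\ l by rewrite !inE n2.
    by have /andP[_] := fe l2 l2D; rewrite !inE -h eqxx.
  - move=> h; have l1D : l1 \in A :\ l by rewrite !inE n1.
    by have /andP[_] := fe l1 l1D; rewrite !inE h eqxx.
  - by apply: fi; rewrite !inE ?n1 ?n2.
move=> k kA; case: eqP => [->|/eqP kl]; first by rewrite lr.
have kD : k \in A :\ l by rewrite !inE kl.
have /andP[->] := fe k kD.
by rewrite !inE => /andP[].
Qed.

Lemma hall : (forall A : {set L}, #|A| <= #|nbrs A setT|) ->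
  exists2 f : L -> R, injective f & forall l, e l (f l).
Proof.
move=> h; have [|f [fi fe]] := @hall_in setT setT; first by move=> A _; apply: h.
exists f => [l l'|l]; first by apply: fi; rewrite inE.
by have /andP[] := fe l (in_setT l).
Qed.

End Hall.

(** * Three disjoint paths *)

Lemma path_iota (T : Type) (r : rel T) (h : nat -> T) m n :
  (forall k, m <= k < m + n -> r (h k) (h k.+1)) -> path r (h m) [seq h k | k <- iota m.+1 n].
Proof.
elim: n m => //= n IH m H; rewrite H ?leqnn /= -?addSnnS ?leq_addr //.
by apply: IH => k /andP[h1 h2]; apply: H; rewrite ltnW // -addSnnS.
Qed.

Definition three_disjoint (V : finType) (t : rel V) (D : {set V}) x y (p q r : seq V) : Prop :=
  [/\ [/\ pth t x y p, pth t x y q & pth t x y r],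
      [/\ p != [::], q != [::] & r != [::]],
      uniq (p ++ q ++ r) & {subset p ++ q ++ r <= D :\: [set x; y]}].

Section MatchingToPaths.
Variables (V : finType) (t : rel V) (D : {set V}) (x y : V).
Let Dxy := D :\: [set x; y].

(* Perfect matchings of this relation encode three disjoint paths: the vertices
   of no path are matched with themselves, and the three copies [inr i] stand
   for [x] on the left and for [y] on the right. *)
Definition flow_rel (a b : V + 'I_3) : bool :=
  match a, b with
  | inl u, inl v => (u == v) || [&& u \in Dxy, v \in Dxy & t u v]
  | inl u, inr _ => (u \in Dxy) && t u y
  | inr _, inl v => (v \in Dxy) && t x v
  | inr _, inr _ => false
  end.

Variable f : V + 'I_3 -> V + 'I_3.
Hypotheses (fi : injective f) (fe : forall a, flow_rel a (f a)).

Definition is_inr (a : V + 'I_3) := if a is inr _ then true else false.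
Definition the_inl (a : V + 'I_3) := if a is inl v then v else x.
Let g i k := the_inl (iter k f (inr i)).

(** An injection of a finite type is a permutation, so the orbit of [inr i] returns to it. The first
    [inr] cannot come after one step, because [flow_rel] relates no two of them. *)
Lemma return_time i : exists n, [/\ 1 < n, is_inr (iter n f (inr i)) &
  forall k, 0 < k < n -> iter k f (inr i) = inl (g i k)].
Proof.
have ex : exists n, (0 < n) && is_inr (iter n f (inr i)).
  by exists (fingraph.order f (inr i)); rewrite fingraph.order_gt0 fingraph.iter_order.
have [n /andP[n0 nr] min] := ex_minnP ex; exists n; split=> //.
  case: n n0 nr {min} => [|[|n]] //= _; have := fe (inr i).
  by case: (f (inr i)).
move=> k /andP[k0 kn]; rewrite /g; case E: (iter k f (inr i)) => [v|j] //=.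
by have := min k; rewrite k0 E /= => /(_ isT); rewrite leqNgt kn.
Qed.

Lemma iter_inj k : injective (iter k f).
Proof. by elim: k => // k IH a b /= /fi /IH. Qed.

(** Cancelling [k] steps puts [inr i] on the orbit of [inr j] at time [l - k]; before the return
    only time [0] carries an [inr]. *)
Lemma orbit_vertex_inj i j n m k l :
  (forall k, 0 < k < n -> iter k f (inr i) = inl (g i k)) ->
  (forall k, 0 < k < m -> iter k f (inr j) = inl (g j k)) ->
  0 < k < n -> 0 < l < m -> g i k = g j l -> i = j /\ k = l.
Proof.
wlog kl : i j n m k l / k <= l.
  move=> W H1 H2 h1 h2 e; case: (leqP k l) => kl; first exact: (W i j n m).
  by have [] := W j i m n l k (ltnW kl) H2 H1 h2 h1 (esym e) => -> ->.
move=> H1 H2 h1 h2 e.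
have : iter k f (inr i) = iter k f (iter (l - k) f (inr j)).
  by rewrite -iterD subnKC // H1 // H2 // e.
move/iter_inj; case: (posnP (l - k)) => [kl0|kl0].
  by rewrite kl0 /= => -[->]; split=> //; move: kl kl0; clear; lia.
by rewrite H2 //; move: h2 kl0; clear; lia.
Qed.

Lemma three_disjoint_of_matching : exists p q r, three_disjoint t D x y p q r.
Proof.
have ex i : exists n, (1 < n) && (is_inr (iter n f (inr i)) &&
    [forall k : 'I_n, (0 < k) ==> (iter k f (inr i) == inl (g i k))]).
  have [n [h1 h2 h3]] := return_time i; exists n; rewrite h1 h2 /=.
  by apply/forallP=> k; apply/implyP=> k0; rewrite h3 // k0 ltn_ord.
pose n i := ex_minn (ex i).
have nP i : [/\ 1 < n i, is_inr (iter (n i) f (inr i)) &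
    forall k, 0 < k < n i -> iter k f (inr i) = inl (g i k)].
  rewrite /n; case: ex_minnP => m /and3P[h1 h2 /forallP h3] _; split=> // k /andP[k0 kn].
  by have := h3 (Ordinal kn); rewrite /= k0 /= => /eqP.
pose p i := [seq g i k | k <- iota 1 (n i).-1].
have gin i k : 0 < k < n i -> g i k \in Dxy.
  have [n1 _ H] := nP i; case: k => // k /andP[_ kn].
  have := fe (iter k f (inr i)); rewrite -iterS (H k.+1) //.
  case: k kn => [|k] kn /=; first by case/andP.
  (* A vertex matched with itself would appear at two consecutive times, which [orbit_vertex_inj]
     excludes. *)
  rewrite -/(iter k.+1 f (inr i)) (H k.+1) ?(ltnW kn) // => /orP[/eqP eg|/and3P[]//].
  have h1 : 0 < k.+1 < n i by rewrite /= (ltnW kn).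
  have h2 : 0 < k.+2 < n i by [].
  have [_ e] := orbit_vertex_inj H H h1 h2 eg.
  by move: e; clear; lia.
have mp i z : z \in p i -> exists2 k, 0 < k < n i & z = g i k.
  case/mapP=> k; rewrite mem_iota => h ->; exists k => //.
  by have [n1 _ _] := nP i; move: h n1; clear; lia.
have pp i : pth t x y (p i).
  have [n1 Hn H] := nP i.
  (* The [inr] at time [0] is read as [x] and the one at time [n i] as [y]. *)
  pose h k := if k == 0 then x else if k == n i then y else g i k.
  have -> : pth t x y (p i) = path t (h 0) [seq h k | k <- iota 1 (n i)].
    rewrite /pth; congr path.
    have -> : iota 1 (n i) = rcons (iota 1 (n i).-1) (n i).
      by case: (n i) n1 => // m _; rewrite -{1}[m.+1]addn1 iotaD -cats1 add1n.
    rewrite map_rcons; congr rcons.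
      apply/eq_in_map=> k; rewrite mem_iota /h => kn.
      case: eqP => [k0|_]; first by move: kn k0; clear; lia.
      by case: eqP => // k0; move: kn k0 n1; clear; lia.
    by rewrite /h eqxx; case: (n i) n1.
  apply: path_iota => k /andP[_]; rewrite add0n => kn; rewrite /h /=.
  have := fe (iter k f (inr i)); rewrite -iterS.
  case: (k.+1 =P n i) => [ek|nk].
    rewrite ek; case E: (iter (n i) f (inr i)) Hn => [//|j] _.
    case: k kn ek => [|k] kn ek; first by move: n1 ek; clear; lia.
    rewrite (H k.+1) /=; last by rewrite kn.
    case: eqP => [ek'|_]; first by move: ek ek'; clear; lia.
    by case/andP.
  rewrite (H k.+1); last by move: kn nk; clear; lia.
  case: k kn nk => [|k] kn nk; first by case/andP.
  rewrite (H k.+1) /=; last by rewrite kn.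
  rewrite (ltn_eqF kn) => /orP[/eqP eg|/and3P[]//].
  have h1 : 0 < k.+1 < n i by [].
  have h2 : 0 < k.+2 < n i by move: kn nk; clear; lia.
  have [_ e] := orbit_vertex_inj H H h1 h2 eg.
  by move: e; clear; lia.
have p0 i : p i != [::].
  by rewrite -size_eq0 size_map size_iota; have [n1 _ _] := nP i; move: n1; clear; lia.
have pu i : uniq (p i).
  have [n1 _ H] := nP i; rewrite map_inj_in_uniq ?iota_uniq // => k l.
  rewrite !mem_iota => hk hl e.
  by have [] := orbit_vertex_inj H H _ _ e; move: hk hl n1; clear; lia.
have pdis i j : i != j -> ~~ has [in p i] (p j).
  move=> ij; apply/hasPn=> z /mp[l hl ->]; apply/negP=> /mp[k hk e].
  have [_ _ Hi] := nP i; have [_ _ Hj] := nP j.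
  by have [e' _] := orbit_vertex_inj Hj Hi hl hk e; move: ij; rewrite e' eqxx.
pose i0 : 'I_3 := inord 0; pose i1 : 'I_3 := inord 1; pose i2 : 'I_3 := inord 2.
have n01 : i0 != i1 by rewrite -val_eqE /= !inordK.
have n02 : i0 != i2 by rewrite -val_eqE /= !inordK.
have n12 : i1 != i2 by rewrite -val_eqE /= !inordK.
exists (p i0), (p i1), (p i2); split=> //.
  by rewrite !cat_uniq !pu has_cat negb_or !pdis.
move=> z; rewrite !mem_cat => /or3P[]/mp[k hk ->]; exact: gin.
Qed.

End MatchingToPaths.

(** If Hall's condition failed for [flow_rel], some set [C] containing [x] could be left only
    through at most two vertices and perhaps the arc [x -> y]. Then [C] and the vertices beyond the
    cut are both too large. *)
Lemma three_disjoint_paths (V : finType) (t : rel V) (D : {set V}) (d : nat) (x y : V) :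
  tournament t -> mindeg t D d -> 4 <= d -> #|D| + 1 <= 3 * d ->
  x \in D -> y \in D -> x != y ->
  exists p q r, three_disjoint t D x y p q r.
Proof.
move=> tT md d4 mD xD yD xy.
set Dxy := D :\: [set x; y].
have DxyP w : w \in D -> [\/ w = x, w = y | w \in Dxy].
  move=> wD; have [->|wx] := eqVneq w x; first by constructor 1.
  have [->|wy] := eqVneq w y; first by constructor 2.
  by constructor 3; rewrite !inE negb_or wx wy.
have xDxy : x \notin Dxy by rewrite !inE eqxx.
have yDxy : y \notin Dxy by rewrite !inE eqxx orbT.
have DxyD w : w \in Dxy -> w \in D by rewrite inE => /andP[].
suff [f fi fe] : exists2 f, injective f & forall a, flow_rel t D x y a (f a).
  exact: (three_disjoint_of_matching fi fe).
apply: (hall (inl x)) => A.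
pose A0 := [set u | inl u \in A].
have inlE (u : V) : (inl u : V + 'I_3) \in A -> inl u \in nbrs (flow_rel t D x y) A setT.
  by move=> uA; apply/nbrsP; split; [rewrite inE|exists (inl u) => //=; rewrite eqxx].
have [/existsP[i iA]|noi] := boolP [exists i : 'I_3, inr i \in A]; last first.
  apply/subset_leq_card/subsetP=> -[u uA|i iA]; first exact: inlE.
  by case/existsP: noi; exists i.
have inl_inj : injective (inl : V -> V + 'I_3) by move=> a b [].
have inr_inj : injective (inr : 'I_3 -> V + 'I_3) by move=> a b [].
pose IL : {set V + 'I_3} := [set inl u | u in A0].
pose IR : {set V + 'I_3} := [set inr i | i in [set: 'I_3]].
have c3 : #|A0| + 3 = #|IL| + #|IR|.
  by rewrite /IL /IR (card_imset _ inl_inj) (card_imset _ inr_inj) cardsT card_ord.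
have cA : #|A| <= #|A0| + 3.
  rewrite c3.
  apply: leq_trans (leq_card_setU _ _); apply/subset_leq_card/subsetP=> -[u uA|j jA].
    by rewrite in_setU imset_f // inE.
  by rewrite in_setU orbC imset_f // inE.
apply: leq_trans cA _.
have [/exists_inP[u uA0 /andP[uD uy]]|noY] :=
    boolP [exists u in A0, (u \in Dxy) && t u y].
  rewrite c3 -cardsUI (_ : _ :&: _ = set0) ?cards0 ?addn0; last first.
    by apply/setP=> a; rewrite !inE; apply/negP=> /andP[/imsetP[? _ ->] /imsetP[]].
  apply/subset_leq_card/subsetP=> a; rewrite in_setU => /orP[]/imsetP[b bA ->].
    by apply: inlE; move: bA; rewrite inE.
  apply/nbrsP; split; first by rewrite inE.
  by exists (inl u); [move: uA0; rewrite inE|rewrite /= -/Dxy uD].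
(* Besides the copies of [A0], the neighbours of [A] include the set [E] of outneighbours of [C]; it
   remains to find three of these. *)
pose C := x |: (A0 :&: Dxy).
pose E := [set w in Dxy | (w \notin A0) && [exists v in C, t v w]].
have inE' w : w \in Dxy -> w \notin A0 -> (exists2 v, v \in C & t v w) -> w \in E.
  by move=> wD wA [v vC vw]; rewrite inE wD wA; apply/exists_inP; exists v.
have CE w : w \in C -> w \in E -> False.
  rewrite in_setU1 in_setI [w \in E]inE => /orP[/eqP->|/andP[wA _]] /and3P[h1 h2 _].
    by move: xDxy; rewrite h1.
  by rewrite wA in h2.
have cE : #|A0| + #|E| <= #|nbrs (flow_rel t D x y) A setT|.
  rewrite -[#|A0|](card_imset _ inl_inj) -[#|E|](card_imset _ inl_inj).
  rewrite -cardsUI (_ : _ :&: _ = set0) ?cards0 ?addn0; last first.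
    apply/setP=> a; rewrite in_setI [RHS]inE;
      apply/negP=> /andP[/imsetP[b bA ->] /imsetP[c cE [bc]]].
    by move: cE; rewrite inE -bc bA /= andbF.
  apply/subset_leq_card/subsetP=> a; rewrite in_setU => /orP[]/imsetP[b bA ->].
    by apply: inlE; move: bA; rewrite inE.
  move: bA; rewrite inE => /and3P[bD _ /exists_inP[v vC vb]].
  apply/nbrsP; split; first by rewrite inE.
  move: vC; rewrite in_setU1 => /orP[/eqP ev|].
    by exists (inr i) => //=; rewrite -/Dxy bD -ev vb.
  rewrite in_setI => /andP[vA vD]; exists (inl v); first by move: vA; rewrite inE.
  by rewrite /= -/Dxy vD bD vb orbT.
apply: leq_trans cE; rewrite leq_add2l leqNgt; apply/negP=> E2.
have clo v w : v \in C -> w \in D -> t v w ->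
    [|| w \in C, w \in E | (v == x) && (w == y)].
  move=> vC wD vw; case: (DxyP w wD) => [->|ew|wDxy].
  - by rewrite /C in_setU1 eqxx.
  - move: (vC); rewrite in_setU1 => /orP[->|]; first by rewrite ew eqxx !orbT.
    rewrite in_setI => /andP[vA vD]; case/exists_inP: noY; exists v => //.
    by rewrite vD -ew.
  - case: (boolP (w \in A0)) => wA; first by rewrite in_setU1 in_setI wA wDxy orbT.
    by rewrite (inE' w) ?orbT //; exists v.
have xC : x \in C by rewrite in_setU1 eqxx.
have CD : C \subset D.
  by apply/subsetP=> w; rewrite in_setU1 in_setI => /orP[/eqP->//|/andP[_ /DxyD]].
have ED : E \subset D by apply/subsetP=> w; rewrite inE => /andP[/DxyD].
have hC : 2 * d + 1 <= #|C| + 2 * #|E|.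
  apply: (closed_out_but_arc tT md CD _ d4 _ clo) => //.
  by apply/set0Pn; exists x.
pose F := D :\: (C :|: E).
have yF : y \in F.
  rewrite in_setD yD andbT in_setU in_setU1 in_setI eq_sym (negbTE xy) /= (negbTE yDxy)
    andbF /=.
  by rewrite inE (negbTE yDxy).
have hF : 2 * d + 1 <= #|F| + 2 * #|E|.
  apply: (@closed_out_but_arc V (converse t) D d F E y x (converse_tournament tT)
    (mindeg_converse md)) => //.
  - exact: subsetDl.
  - by apply/set0Pn; exists y.
  move=> v w; rewrite /converse in_setD in_setU negb_or => /andP[/andP[vC vE] vD] wD wv.
  rewrite in_setD in_setU wD andbT.
  case: (boolP (w \in E)) => [|wE]; rewrite ?orbT // orbF.
  case: (boolP (w \in C)) => // wC; have := clo w v wC vD wv.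
  by rewrite (negbTE vC) (negbTE vE) /= andbC.
have cD : #|C| + #|E| + #|F| = #|D|.
  have := cardsID (C :|: E) D; rewrite -/F (setIidPr _); last by rewrite subUset CD ED.
  rewrite cardsU (_ : C :&: E = set0) ?cards0; first by clear; lia.
  by apply/setP=> w; rewrite in_setI [RHS]inE; apply/negP=> /andP[/CE].
(* Adding up gives [4 d + 2 <= #|D| + 3 #|E| <= 3 d + 5]. *)
move: hC hF cD E2 mD d4; clear; lia.
Qed.

(** * Hamiltonian paths and cycles *)

Section Hamilton.
Variables (V : finType) (t : rel V).
Hypothesis tT : tournament t.

(** Follow the path from [u]: [w] fits before the first vertex that does not dominate it, or at the
    end. *)
Lemma insert_after s p w u : path t s p -> w \notin s :: p -> u \in s :: p -> t u w ->
  exists2 p', path t s p' & perm_eq p' (w :: p).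
Proof.
elim: p s u => [|h p IH] s u /=.
  by rewrite !inE => _ ws /eqP-> sw; exists [:: w] => //=; rewrite sw.
move=> /andP[sh ph] wn un uw.
have wn' : w \notin h :: p by apply: contra wn => h'; rewrite inE h' orbT.
have rec u' : u' \in h :: p -> t u' w -> exists2 p', path t s p' & perm_eq p' [:: w, h & p].
  move=> u'n u'w; have [q pq e] := IH h u' ph wn' u'n u'w.
  exists (h :: q); first by rewrite /= sh.
  by apply/permP=> f; move/permP: e => /(_ f) /=; lia.
have [sw|sw] := boolP (t s w); last first.
  apply: (rec u) => //; move: un; rewrite inE => /orP[/eqP us|//].
  by rewrite -us uw in sw.
have [wh|wh] := boolP (t w h); first by exists [:: w, h & p] => //=; rewrite sw wh.
apply: (rec h); first exact: mem_head.
by apply: (tourN tT) wh; move: wn'; rewrite inE negb_or => /andP[].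
Qed.

(** The path grows one vertex at a time: the hypothesis supplies an arc leaving its vertex set, and
    the head of that arc is inserted. *)
Lemma hamilton_from (N : {set V}) s : s \in N ->
  (forall C : {set V}, C \subset N -> s \in C -> C != N ->
     exists u w, [/\ u \in C, w \in N :\: C & t u w]) ->
  exists p, [/\ path t s p, uniq (s :: p) & (s :: p) =i N].
Proof.
move=> sN H.
suff G n : n < #|N| -> exists p, [/\ path t s p, uniq (s :: p), {subset s :: p <= N} &
  size p = n].
  have N0 : 0 < #|N| by apply/card_gt0P; exists s.
  have [|p [pp up sp szp]] := G #|N|.-1; first by rewrite prednK.
  exists p; split=> //; have eC : [set z in s :: p] = N.
    apply/eqP; rewrite eqEcard cardsE (card_uniqP up) /= szp prednK // leqnn andbT.
    by apply/subsetP=> z; rewrite inE => /sp.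
  by move=> z; rewrite -eC [RHS]inE.
elim: n => [|n IH] nN.
  by exists [::]; split=> // z; rewrite inE => /eqP->.
have [p [pp up sp szp]] := IH (ltnW nN).
pose C := [set z in s :: p].
have [||| u [w [uC wC uw]]] := H C.
- by apply/subsetP=> z; rewrite inE => /sp.
- by rewrite inE mem_head.
- apply/eqP=> eC; move: nN; rewrite -eC cardsE (card_uniqP up) /= szp.
  by rewrite ltnn.
move: uC wC; rewrite inE => uC; rewrite in_setD inE => /andP[wC wN].
have [q pq e] := insert_after pp wC uC uw.
exists q; split=> //.
- rewrite (@perm_uniq _ _ [:: s, w & p]) ?perm_cons // -(@perm_uniq _ (w :: s :: p)).
    by rewrite /= wC.
  by apply/permP=> f /=; clear; lia.
- move=> z; rewrite inE (perm_mem e) => /orP[/eqP->//|].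
  by rewrite inE => /orP[/eqP->//|zp]; apply: sp; rewrite inE zp orbT.
- by rewrite (perm_size e) /= szp.
Qed.

End Hamilton.

Section HamiltonCycle.
Variables (V : finType) (t : rel V).
Hypothesis tT : tournament t.

Lemma hamilton_to (N : {set V}) b : b \in N ->
  (forall C : {set V}, C \subset N -> b \in C -> C != N ->
     exists u w, [/\ u \in C, w \in N :\: C & t w u]) ->
  exists a p, [/\ path t a p, last a p = b, uniq (a :: p) & (a :: p) =i N].
Proof.
move=> bN H; have [q [pq uq eq]] := hamilton_from (converse_tournament tT) bN H.
have er : last b q :: rev (belast b q) = rev (b :: q) by rewrite [in RHS]lastI rev_rcons.
exists (last b q), (rev (belast b q)); split.
- by rewrite rev_path.
- by case: (q) => // z q'; rewrite /= rev_cons last_rcons.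
- by rewrite er rev_uniq.
- by rewrite er => z; rewrite mem_rev eq.
Qed.

Variable N : {set V}.
Hypothesis strong : forall C : {set V}, C \subset N -> C != set0 -> C != N ->
  exists u w, [/\ u \in C, w \in N :\: C & t u w].

Lemma linked_rotate u s z : linked t u u s -> z \in u :: s ->
  exists2 s', linked t z z s' & perm_eq (u :: s) (z :: s').
Proof.
move=> L; rewrite inE => /orP[/eqP->|zs]; first by exists s.
have [s1 [s2 [L1 L2 e]]] := linked_mem L zs.
exists (s2 ++ u :: s1); first exact: linked_cat.
by apply/permP=> f; move/permP: e => /(_ f); rewrite /= !count_cat /=; clear; lia.
Qed.

(** A vertex with both an inneighbour and an outneighbour on the cycle is inserted after a rotation.
    Otherwise each outside vertex is dominated by the whole cycle or dominates it; strong
    connectivity gives an arc [o -> i] from the first kind to the second, which fits right after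
    [u]. *)
Lemma hamilton_cycle_grow u s : linked t u u s -> s != [::] -> uniq (u :: s) ->
  {subset u :: s <= N} -> [set z in u :: s] != N ->
  exists u' s', [/\ linked t u' u' s', s' != [::], uniq (u' :: s'),
    {subset u' :: s' <= N} & size s < size s'].
Proof.
move=> L s0 us sN neN.
have cat0 (s' c : seq V) : c != [::] -> s' ++ c != [::] by case: s'.
have [/existsP[w /and3P[wN wn /andP[/hasP[z zs zw] /hasP[z' zs' wz]]]]|no] := boolP
   [exists w, [&& w \in N, w \notin u :: s & has (fun z =>
     t z w) (u :: s) && has (t w) (u :: s)]].
  have [s' L' e] := linked_rotate L zs.
  have uw : uniq (z :: s' ++ [:: w]).
    rewrite -cat_cons -(@perm_uniq _ ((u :: s) ++ [:: w])) ?perm_cat2r // cat_uniq us /= orbF.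
    by rewrite wn.
  exists z, (s' ++ [:: w]); split=> //.
  - have zs2 : z' \in s'.
      move: zs'; rewrite (perm_mem e) inE => /orP[/eqP zz|//].
      by move: (tourF tT wz); rewrite zz zw.
    apply: (linked_head tT L' zs2); last by move: uw; rewrite /= => /andP[].
    by exists [:: w] => //; rewrite /pth /= zw wz.
  - exact: cat0.
  - move=> q; rewrite -cat_cons mem_cat -(perm_mem e) => /orP[/sN//|].
    by rewrite inE => /eqP->.
  - by have := perm_size e; rewrite size_cat /= => -[->]; rewrite addn1.
have {}no w : w \in N -> w \notin u :: s ->
    {in u :: s, forall z, t z w} \/ {in u :: s, forall z, t w z}.
  move=> wN wn; move/existsPn: no => /(_ w);
    rewrite wN wn !andTb negb_and => /orP[]/hasPn h; [right|left] => z zs.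
    by apply: (tourN tT) (h z zs); apply: contraNneq wn => <-.
  by apply: (tourN tT) (h z zs); apply: contraNneq wn => ->.
pose O := [set w in N | (w \notin u :: s) && t u w].
have CN : [set z in u :: s] \subset N by apply/subsetP=> z; rewrite inE => /sN.
have ON : O \subset N by apply/subsetP=> z; rewrite inE => /andP[].
have [||z [w [zC wC zw]]] := strong CN.
- by apply/set0Pn; exists u; rewrite inE mem_head.
- exact: neN.
move: zC wC; rewrite inE => zs; rewrite in_setD inE => /andP[wn wN].
have wO : w \in O.
  rewrite inE wN wn; case: (no w wN wn) => [h|h]; first by rewrite h // mem_head.
  by move: (tourF tT zw); rewrite h.
have [||o [i [oO iO oi]]] := strong ON.
- by apply/set0Pn; exists w.
- apply: contraTneq (sN u (mem_head _ _)) => <-; rewrite inE mem_head andbF //.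
move: oO iO; rewrite inE in_setD [i \in O]inE => /and3P[oN on uo] /andP[iO iN].
have ho : {in u :: s, forall z, t z o}.
  case: (no o oN on) => // h; by move: (tourF tT uo); rewrite h // mem_head.
have in_ : i \notin u :: s.
  by apply/negP=> is_; move: (tourF tT oi); rewrite ho.
have hi : {in u :: s, forall z, t i z}.
  case: (no i iN in_) => // h; case/negP: iO; rewrite iN in_ h //.
  exact: mem_head.
case: s s0 L us sN {neN no O CN ON wO zs wn cat0} on ho in_ hi {uo iO} =>
  // h s _ L us sN on ho in_ hi.
have uoi : uniq (u :: (h :: s) ++ [:: o; i]).
  rewrite -cat_cons cat_uniq us /= orbF -!/(_ \in u :: h :: s) negb_or on in_ /=.
  by rewrite inE (tour_neq tT oi).
exists u, ((h :: s) ++ [:: o; i]); split=> //.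
- apply: (linked_head tT L (mem_head _ _)); last by move: uoi => /= /andP[].
  by exists [:: o; i] => //; rewrite /pth /= ho ?mem_head // oi hi // !inE eqxx orbT.
- move=> q; rewrite -cat_cons mem_cat => /orP[/sN//|].
  by rewrite !inE => /orP[]/eqP->.
- by rewrite size_cat /= addn2 ltnS leqnSn.
Qed.

Lemma hamilton_cycle : 1 < #|N| ->
  exists u p, [/\ pth t u u p, uniq (u :: p) & (u :: p) =i N].
Proof.
move=> N1.
have [v vN] : exists v, v \in N by apply/card_gt0P; apply: ltnW.
have [|||v' [o [v'v oN vo]]] := strong (C := [set v]).
- by rewrite sub1set.
- by apply/set0Pn; exists v; rewrite inE.
- by apply: contraTneq N1 => <-; rewrite cards1.
move: v'v vo oN; rewrite inE => /eqP-> vo; rewrite in_setD => /andP[_ oN].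
(* An arc [u -> w] leaving the outneighbourhood of [v] closes a triangle [v -> u -> w -> v], the
   initial cycle. *)
pose O := [set w in N | t v w].
have [|||u [w [uO wO uw]]] := strong (C := O).
- by apply/subsetP=> z; rewrite inE => /andP[].
- by apply/set0Pn; exists o; rewrite inE oN.
- by apply: contraTneq vN => <-; rewrite inE (proj1 tT) andbF.
move: uO wO; rewrite inE in_setD [w \in O]inE => /andP[uN vu] /andP[wO wN].
have wv : w != v by apply: contraTneq uw => ->; rewrite (tourF tT vu).
have wv' : t w v.
  by apply: (tourN tT) (_ : ~~ t v w); rewrite 1?eq_sym //; move: wO; rewrite wN.
have start : exists u s, [/\ linked t u u s, s != [::], uniq (u :: s),
    {subset u :: s <= N} & 0 < size s].
  exists v, [:: u; w]; split=> //.
  - by exists [:: u; w] => //; rewrite /pth /= vu uw wv'.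
  - by rewrite /= !inE negb_or (tour_neq tT vu) (tour_neq tT uw) eq_sym wv.
  - by move=> z; rewrite !inE => /or3P[]/eqP->.
suff G n : (exists u s, [/\ linked t u u s, s != [::], uniq (u :: s),
    {subset u :: s <= N} & n <= size s]) \/
    (exists u p, [/\ pth t u u p, uniq (u :: p) & (u :: p) =i N]).
  case: (G #|N|) => // -[u' [s [_ _ us sN]]].
  have : #|[set z in u' :: s]| <= #|N|.
    by apply/subset_leq_card/subsetP=> z; rewrite inE => /sN.
  by rewrite cardsE (card_uniqP us) /= ltnNge => /negbTE->.
elim: n => [|n [[u' [s [L s0 us sN ns]]]|]]; last by right.
  by left; have [u' [s [? ? ? ? ?]]] := start; exists u', s.
have [eN|neN] := eqVneq [set z in u' :: s] N.
  right; have [p pp e] := L; exists u', p; split=> //.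
    by rewrite (@perm_uniq _ _ (u' :: s)) ?perm_cons.
  by move=> z; rewrite -eN !inE (perm_mem e).
left; have [u2 [s2 [? ? ? ? lt]]] := hamilton_cycle_grow L s0 us sN neN.
by exists u2, s2; split=> //; apply: leq_ltn_trans ns lt.
Qed.

(** The cycle is unrolled over the naturals, so that a window of consecutive vertices may start
    anywhere. *)
Lemma hamilton_periodic : 1 < #|N| -> exists h : nat -> V,
  [/\ forall i, t (h i) (h i.+1), forall i, h (i + #|N|) = h i,
      forall i j, i < j < i + #|N| -> h i != h j, forall i, h i \in N &
      forall v, v \in N -> exists i, h i = v].
Proof.
move=> N1; have [u [p [pp up eN]]] := hamilton_cycle N1.
have szN : #|N| = (size p).+1 by rewrite -(eq_card eN) (card_uniqP up).
pose h i := nth u (u :: p) (i %% #|N|).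
have N0 : 0 < #|N| by apply: ltnW.
have lt i : i %% #|N| < size (u :: p) by rewrite /= -szN ltn_mod.
exists h; split.
- move=> i; move/(pathP u): (pp) => /(_ (i %% #|N|));
    rewrite size_rcons -szN ltn_mod N0 => /(_ isT).
  have -> : nth u (u :: rcons p u) (i %% #|N|) = h i.
    rewrite /h -rcons_cons nth_rcons lt //.
  congr (t _ _); rewrite /h nth_rcons.
  have m1 : i.+1 %% #|N| = if (i %% #|N|).+1 == #|N| then 0 else (i %% #|N|).+1.
    rewrite -[i.+1]addn1 -modnDml addn1; case: eqP => [->|/eqP ne]; first by rewrite modnn.
    by apply: modn_small; rewrite ltn_neqAle ne ltn_mod.
  rewrite m1; move: (ltn_mod i #|N|); rewrite N0 szN ltnS eqSS leq_eqVlt.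
  case: (i %% (size p).+1 =P size p) => [->|ne /= ->//]; first by rewrite ltnn.
- by move=> i; rewrite /h modnDr.
- move=> i j /andP[ij ji]; rewrite /h nth_uniq //; apply/negP.
  move/eqP=> e; have : (j - i) %% #|N| = 0.
    by apply/eqP; rewrite -[_ == 0]/(#|N| %| j - i) -eqn_mod_dvd ?e //; apply: ltnW.
  by rewrite modn_small; move: ij ji; clear; lia.
- by move=> i; rewrite -eN mem_nth.
- move=> v; rewrite -eN => vp; exists (index v (u :: p)).
  by rewrite /h modn_small ?nth_index // szN -[(size p).+1]/(size (u :: p)) index_mem.
Qed.

End HamiltonCycle.

(** * Absorbing a chain into three disjoint paths *)

Section Absorption.
Variables (V : finType) (t : rel V) (x y : V).
Hypothesis tT : tournament t.

Lemma chain_split (Q : pred V) a c : Q a -> ~~ Q (last a c) ->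
  exists c1 b c2, [/\ c = c1 ++ b :: c2, Q (last a c1) & ~~ Q b].
Proof.
elim: c a => [|b c IH] a /= Qa Ql; first by rewrite Qa in Ql.
have [Qb|Qb] := boolP (Q b); last by exists [::], b, c.
have [c1 [b' [c2 [-> h1 h2]]]] := IH b Qb Ql.
by exists (b :: c1), b', c2.
Qed.

Lemma absorb3_cross p q r c a z z' : linked t x y p -> linked t x y q -> linked t x y r ->
  path t a c -> uniq (p ++ q ++ r ++ a :: c) ->
  z \in p -> t z a -> z' \in q -> t (last a c) z' ->
  linked t x y (p ++ q ++ r ++ a :: c).
Proof.
move=> Lp Lq Lr pc u zp za zq lz.
have e : perm_eq ((p ++ q ++ a :: c) ++ r) (p ++ q ++ r ++ a :: c).
  by apply/permP=> f; rewrite !count_cat; clear; lia.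
apply: (linked_perm e); rewrite -(perm_uniq e) in u.
apply: linked_merge => //; apply: (absorb_cross tT Lp Lq zp zq za lz) => //.
by move: u; rewrite cat_uniq => /and3P[].
Qed.

(* When the chain can only leave from and return to [p], cut it after the last vertex
   that dominates some vertex of [q] or [r]: the first part crosses from [p] to one of
   them, and the second part crosses from the other one back to [p]. *)
Lemma absorb3_same p q r c a z z' : linked t x y p -> linked t x y q -> linked t x y r ->
  q != [::] -> r != [::] ->
  path t a c -> uniq (p ++ q ++ r ++ a :: c) ->
  z \in p -> t z a -> z' \in p -> t (last a c) z' ->
  linked t x y (p ++ q ++ r ++ a :: c).
Proof.
move=> Lp Lq Lr q0 r0 pc u zp za zp' lz.
have e1 : perm_eq (p ++ r ++ q ++ a :: c) (p ++ q ++ r ++ a :: c).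
  by apply/permP=> f; rewrite !count_cat; clear; lia.
have e2 : perm_eq (q ++ p ++ r ++ a :: c) (p ++ q ++ r ++ a :: c).
  by apply/permP=> f; rewrite !count_cat; clear; lia.
have e3 : perm_eq (r ++ p ++ q ++ a :: c) (p ++ q ++ r ++ a :: c).
  by apply/permP=> f; rewrite !count_cat; clear; lia.
(* If either end of the chain can be attached to [q] or [r], the chain crosses between two paths.
   Otherwise [a] dominates all of [q] and [r], and the last vertex none of them. *)
have [/hasP[w wq wa]|na] := boolP (has (fun w => t w a) (q ++ r)).
  move: wq; rewrite mem_cat => /orP[wq|wr].
    by apply: (linked_perm e2); apply: (@absorb3_cross q p r c a w z') => //;
      rewrite (perm_uniq e2).
  by apply: (linked_perm e3); apply: (@absorb3_cross r p q c a w z') => //;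
    rewrite (perm_uniq e3).
pose Q v := has (t v) (q ++ r).
have [/hasP[w wq wa]|nl] := boolP (Q (last a c)).
  move: wq; rewrite mem_cat => /orP[wq|wr].
    exact: (@absorb3_cross p q r c a z w).
  by apply: (linked_perm e1); apply: (@absorb3_cross p r q c a z w) => //;
    rewrite (perm_uniq e1).
have nin b : b \in a :: c -> {in q ++ r, forall w, w != b}.
  move=> bc w wqr; apply/eqP=> wb.
  have : uniq ((p ++ q ++ r) ++ a :: c) by rewrite -!catA.
  rewrite cat_uniq => /and3P[_ /hasPn h _]; have := h b bc.
  by rewrite -wb /= mem_cat wqr orbT.
have Qa : Q a.
  have [w wq] : exists w, w \in q by case: (q) q0 => // w ? _; exists w; rewrite mem_head.
  have wqr : w \in q ++ r by rewrite mem_cat wq.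
  apply/hasP; exists w => //; move/hasPn: na => /(_ w wqr).
  by apply: (tourN tT); apply: nin => //; apply: mem_head.
have [c1 [b [c2 [ec Q1 Qb]]]] := chain_split Qa nl.
have lb w : w \in q ++ r -> t w b.
  move=> wqr; move/hasPn: Qb => /(_ w wqr) h; apply: (tourN tT) h.
  by rewrite eq_sym; apply: nin => //; rewrite ec !(inE, mem_cat) eqxx !orbT.
have /and3P[pc1 _ pc2] : [&& path t a c1, t (last a c1) b & path t b c2].
  by move: pc; rewrite ec cat_path.
have lz2 : t (last b c2) z' by move: lz; rewrite ec last_cat.
have main q1 r1 w : linked t x y q1 -> linked t x y r1 -> r1 != [::] ->
    {subset r1 <= q ++ r} -> perm_eq (q1 ++ r1) (q ++ r) ->
    w \in q1 -> t (last a c1) w -> linked t x y (p ++ q ++ r ++ a :: c).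
  move=> Lq1 Lr1 r10 sr1 e wq lw.
  have e' : perm_eq (r1 ++ (p ++ q1 ++ a :: c1) ++ b :: c2) (p ++ q ++ r ++ a :: c).
    rewrite ec; apply/permP=> f; move/permP: e => /(_ f).
    by rewrite !(count_cat, =^~ cat_cons) /= ?count_cat /=; clear; lia.
  apply: (linked_perm e'); rewrite -(perm_uniq e') in u.
  have [g gr] : exists g, g \in r1 by case: (r1) r10 => // g ? _; exists g; rewrite mem_head.
  apply: (@absorb_cross _ _ _ _ tT r1 (p ++ q1 ++ a :: c1) c2 b (last b c2) g z') => //.
  - apply: (@absorb_cross _ _ _ _ tT p q1 c1 a (last a c1) z w) => //.
    by move: u; rewrite !cat_uniq => /and3P[_ _ /and3P[]].
  - by rewrite mem_cat zp'.
  - by apply: lb; apply: sr1.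
case/hasP: Q1 => w wqr lw; move: wqr; rewrite mem_cat => /orP[wq|wr].
  by apply: (main q r w) => // g gr; rewrite mem_cat gr orbT.
apply: (main r q w) => //; last by rewrite perm_catC.
by move=> g gr; rewrite mem_cat gr.
Qed.

(** A chain attached to [x] or [y] is absorbed by the merger of the three paths. Otherwise it hangs
    on two inner vertices, and up to renaming the paths one of the two preceding lemmas applies. *)
Lemma absorb3 p q r c a : linked t x y p -> linked t x y q -> linked t x y r ->
  p != [::] -> q != [::] -> r != [::] ->
  path t a c -> uniq (p ++ q ++ r ++ a :: c) ->
  start_ok t x (p ++ q ++ r) a -> end_ok t y (p ++ q ++ r) (last a c) ->
  linked t x y (p ++ q ++ r ++ a :: c).
Proof.
move=> Lp Lq Lr p0 q0 r0 pc u sa el.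
have u' : uniq ((p ++ q ++ r) ++ a :: c) by rewrite -!catA.
have u3 : uniq (p ++ q ++ r) by move: u'; rewrite cat_uniq => /and3P[].
have u2 : uniq (q ++ r) by move: u3; rewrite cat_uniq => /and3P[].
have L3 : linked t x y (p ++ q ++ r) by apply: linked_merge => //; apply: linked_merge.
have [xa|xa] := boolP (t x a).
  have -> : p ++ q ++ r ++ a :: c = (p ++ q ++ r) ++ a :: c by rewrite -!catA.
  exact: (absorb_free tT L3 pc (erefl _)).
have [ly|ly] := boolP (t (last a c) y).
  have -> : p ++ q ++ r ++ a :: c = (p ++ q ++ r) ++ a :: c by rewrite -!catA.
  exact: (absorb_free_end tT L3 pc (erefl _)).
move: sa el; rewrite /start_ok /end_ok (negbTE xa) (negbTE ly) /=.
case/hasP=> z zs za /hasP[z' zs' lz].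
have any p1 q1 r1 : linked t x y p1 -> linked t x y q1 -> linked t x y r1 ->
    q1 != [::] -> r1 != [::] -> perm_eq (p1 ++ q1 ++ r1) (p ++ q ++ r) ->
    z \in p1 -> linked t x y (p ++ q ++ r ++ a :: c).
  move=> L1 L2 L3' q10 r10 e zp1.
  have e' : perm_eq (p1 ++ q1 ++ r1 ++ a :: c) (p ++ q ++ r ++ a :: c).
    apply/permP=> f; move/permP: e => /(_ f); rewrite !count_cat; clear; lia.
  apply: (linked_perm e').
  move: zs'; rewrite -(perm_mem e) !mem_cat => /or3P[z1|z1|z1].
  - by apply: (@absorb3_same p1 q1 r1 c a z z') => //; rewrite (perm_uniq e').
  - by apply: (@absorb3_cross p1 q1 r1 c a z z') => //; rewrite (perm_uniq e').
  - have e2 : perm_eq (p1 ++ r1 ++ q1 ++ a :: c) (p1 ++ q1 ++ r1 ++ a :: c).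
      by apply/permP=> f; rewrite !count_cat; clear; lia.
    apply: (linked_perm e2).
    by apply: (@absorb3_cross p1 r1 q1 c a z z') => //; rewrite (perm_uniq e2) (perm_uniq e').
move: zs; rewrite !mem_cat => /or3P[zp|zq|zr].
- exact: (any p q r).
- apply: (any q p r) => //; apply/permP=> f; rewrite !count_cat; clear; lia.
- apply: (any r p q) => //; apply/permP=> f; rewrite !count_cat; clear; lia.
Qed.

End Absorption.

Lemma last_iotaS k m : last k (iota k.+1 m) = k + m.
Proof. by elim: m k => [|m IH] k; rewrite ?addn0 //= IH addSnnS. Qed.

(** * Filling up three disjoint paths *)

Section Triple.
Variables (V : finType) (t : rel V) (D : {set V}) (d : nat) (x y : V).
Hypotheses (tT : tournament t) (md : mindeg t D d) (d4 : 4 <= d).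
Hypotheses (mD : #|D| + 1 <= 3 * d) (xD : x \in D) (yD : y \in D) (xy : x != y).
Variables (p q r : seq V) (e : nat).
Hypothesis td : three_disjoint t D x y p q r.
Let s := p ++ q ++ r.
Let Dxy := D :\: [set x; y].
Let N := [set v in Dxy | v \notin s].
Hypotheses (e0 : 0 < e) (eN : e <= #|N|).
Hypothesis no : ~ has_inner t D x y (size s + e).

Let us : uniq s. Proof. by case: td. Qed.
Let sD : {subset s <= Dxy}. Proof. by case: td. Qed.

Lemma restP n : n \in N -> n \in Dxy /\ n \notin s.
Proof. by rewrite inE => /andP[]. Qed.

Lemma uniq_chain c : uniq c -> {subset c <= N} ->
  uniq (s ++ c) /\ {subset s ++ c <= Dxy}.
Proof.
move=> uc cN; split.
  by rewrite cat_uniq us uc andbT /=; apply/hasPn=> z /cN/restP[].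
by move=> z; rewrite mem_cat => /orP[/sD//|/cN/restP[]].
Qed.

Lemma no_chain a c : path t a c -> uniq (a :: c) -> {subset a :: c <= N} ->
  size (a :: c) = e -> start_ok t x s a -> end_ok t y s (last a c) -> False.
Proof.
move=> pc uc cN sz sa el; have [u1 D1] := uniq_chain uc cN.
case: td => [[pp pq pr] [p0 q0 r0] _ _]; apply: no.
rewrite -sz -size_cat; apply: linked_has_inner => //; rewrite -!catA.
by apply: absorb3 => //; try exact: pth_linked; rewrite -/s !catA -!catA in u1 *.
Qed.

(** A bad end is dominated by all of [s] and a bad start dominates all of [s], so this chain of
    [e + 1] vertices could replace one inner vertex. *)
Lemma no_drop b c : path t b c -> uniq (b :: c) -> {subset b :: c <= N} ->
  size c = e -> ~~ end_ok t y s b -> ~~ start_ok t x s (last b c) -> False.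
Proof.
move=> pc uc cN sz eb sl; have [u1 D1] := uniq_chain uc cN.
case: td => [[pp pq pr] [p0 q0 r0] _ _]; apply: no.
have [R pR eR] : linked t x y s.
  apply: linked_merge => //; first exact: pth_linked.
  apply: linked_merge => //; try exact: pth_linked.
  by move: us; rewrite /s cat_uniq => /and3P[].
have szR := perm_size eR; rewrite -szR -sz.
have [bD bs] := restP (cN b (mem_head _ _)).
have [lD ls] := restP (cN _ (mem_last b c)).
have [_ hb] := end_okN tT bD bs eb.
have [_ hl] := start_okN tT lD ls sl.
apply: (@insert_dropping_one V t D x y R b c) => //.
- rewrite szR /s !size_cat.
  by move: p0 q0 r0; rewrite -!size_eq0 -!lt0n; clear; lia.
- by move=> z; rewrite (perm_mem eR); apply: hb.
- by move=> z; rewrite (perm_mem eR); apply: hl.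
- by rewrite (@perm_uniq _ _ (s ++ b :: c)) // perm_cat2r.
- by move=> z; rewrite mem_cat (perm_mem eR) -mem_cat => /D1.
Qed.

Lemma start_or_end n : n \in N -> start_ok t x s n || end_ok t y s n.
Proof.
move=> /restP[nD ns]; apply/negPn/negP; rewrite negb_or => /andP[h1 h2].
have [_ hs] := start_okN tT nD ns h1; have [_ he] := end_okN tT nD ns h2.
case: td => _ [p0 _ _] _ _.
have [z zs] : exists z, z \in s by rewrite /s; case: (p) p0 => // z ? _; exists z;
  rewrite mem_head.
by move: (tourF tT (hs z zs)); rewrite he.
Qed.

Lemma triple_cases w : w \in D -> [\/ w = x, w = y, w \in s | w \in N].
Proof.
move=> wD; have [->|wx] := eqVneq w x; first by constructor 1.
have [->|wy] := eqVneq w y; first by constructor 2.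
have [wp|wp] := boolP (w \in s); first by constructor 3.
by constructor 4; rewrite !inE negb_or wx wy wD.
Qed.

Lemma rest_sub n : n \in N -> n \in D.
Proof. by case/restP; rewrite inE => /andP[]. Qed.

Lemma rest_neq n : n \in N -> (n != x) && (n != y).
Proof. by case/restP; rewrite !inE negb_or => /andP[]. Qed.

(** A bad start dominates [x] and [s]. If [C] had only bad starts, its only possible inneighbour
    outside would be [y], contrary to [cut_bound]. *)
Lemma source_start (C : {set V}) : C \subset N -> C != set0 ->
  (forall u w, u \in N :\: C -> w \in C -> ~~ t u w) -> exists2 a, a \in C & start_ok t x s a.
Proof.
move=> CN C0 clo.
have [/exists_inP//|/exists_inPn bad] := boolP [exists a in C, start_ok t x s a].
exfalso.
have CD : C \subset D by apply/subsetP=> w /(subsetP CN)/rest_sub.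
apply: (cut_bound (E := [set y]) tT md CD C0) => //; rewrite ?cards1 //.
- apply/set0Pn; exists x; rewrite in_setD xD andbT in_setU in_set1 negb_or xy andbT.
  by apply/negP=> /(subsetP CN)/rest_neq; rewrite eqxx.
- by apply: leq_trans d4.
- move=> v w vC wD wv; rewrite in_set1.
  have vN := subsetP CN v vC; have [vD vs] := restP vN.
  have [h1 h2] := start_okN tT vD vs (bad v vC).
  case: (triple_cases wD) => [wx|->|ws|wN].
  + by move: (tourF tT h1); rewrite -wx wv.
  + by rewrite eqxx orbT.
  + by move: (tourF tT (h2 w ws)); rewrite wv.
  + case: (boolP (w \in C)) => // wC; have := clo w v _ vC.
    by rewrite in_setD wC wN wv => /(_ isT).
Qed.

Lemma sink_end (C : {set V}) : C \subset N -> C != set0 ->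
  (forall u w, u \in N :\: C -> w \in C -> ~~ t w u) -> exists2 a, a \in C & end_ok t y s a.
Proof.
move=> CN C0 clo.
have [/exists_inP//|/exists_inPn bad] := boolP [exists a in C, end_ok t y s a].
exfalso.
have CD : C \subset D by apply/subsetP=> w /(subsetP CN)/rest_sub.
apply: (cut_bound (E := [set x]) (converse_tournament tT) (mindeg_converse md) CD C0) =>
  //; rewrite ?cards1 //.
- apply/set0Pn; exists y; rewrite in_setD yD andbT in_setU in_set1 negb_or eq_sym xy andbT.
  by apply/negP=> /(subsetP CN)/rest_neq; rewrite eqxx andbF.
- by apply: leq_trans d4.
- move=> v w vC wD; rewrite /converse => wv; rewrite in_set1.
  have vN := subsetP CN v vC; have [vD vs] := restP vN.
  have [h1 h2] := end_okN tT vD vs (bad v vC).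
  case: (triple_cases wD) => [->|wx|ws|wN].
  + by rewrite eqxx orbT.
  + by move: (tourF tT h1); rewrite -wx wv.
  + by move: (tourF tT (h2 w ws)); rewrite wv.
  + case: (boolP (w \in C)) => // wC; have := clo w v _ vC.
    by rewrite in_setD wC wN wv => /(_ isT).
Qed.

Lemma rest_neq0 : N != set0.
Proof. by rewrite -card_gt0; apply: leq_trans eN. Qed.

(* If every window of [e] vertices of the Hamiltonian cycle has a bad end, then being a
   bad end is invariant under a shift by [e - 1]; since a window of [e + 1] vertices from
   a bad end to a bad start could replace one inner vertex, it is also invariant under a
   shift by [e], hence under every shift. *)
Lemma rest_not_strong : (forall C : {set V}, C \subset N -> C != set0 -> C != N ->
  exists u w, [/\ u \in C, w \in N :\: C & t u w]) -> False.
Proof.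
move=> strong.
have emp u : u \in N :\: N = false by rewrite setDv inE.
have [a aN sa] : exists2 a, a \in N & start_ok t x s a.
  by apply: source_start => // [|u w]; rewrite ?rest_neq0 // emp.
have [b bN eb] : exists2 a, a \in N & end_ok t y s a.
  by apply: sink_end => // [|u w]; rewrite ?rest_neq0 // emp.
have [N1|N1] := leqP #|N| 1.
  have N1' : #|N| == 1 by rewrite eqn_leq N1 card_gt0 rest_neq0.
  have ab : a = b.
    by move: aN bN; case/cards1P: N1' => z ->; rewrite !inE => /eqP-> /eqP->.
  apply: (@no_chain a [::]) => //; last by rewrite /= ab.
    by move=> z; rewrite inE => /eqP->.
  by move: e0 eN N1; rewrite /=; clear; lia.
have [h [ht hper hinj hN hsurj]] := hamilton_periodic tT strong N1.
have l0 : 0 < #|N| by apply: ltnW.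
pose A i := ~~ start_ok t x s (h i); pose B i := ~~ end_ok t y s (h i).
have hper' i k : h (i + k * #|N|) = h i.
  by elim: k => [|k IH]; rewrite ?mul0n ?addn0 // mulSn [#|N| + _]addnC addnA hper.
have AB i : B i -> A i = false.
  by move=> bi; apply/negbTE; rewrite negbK; have := start_or_end (hN i);
    rewrite (negbTE bi) orbF.
have win i n : n < #|N| -> [/\ path t (h i) [seq h k | k <- iota i.+1 n],
    uniq (h i :: [seq h k | k <- iota i.+1 n]),
    {subset h i :: [seq h k | k <- iota i.+1 n] <= N} &
    last (h i) [seq h k | k <- iota i.+1 n] = h (i + n)].
  move=> nN; have es : h i :: [seq h k | k <- iota i.+1 n] = [seq h k | k <- iota i n.+1] by [].
  split.
  - by apply: path_iota.
  - rewrite es map_inj_in_uniq ?iota_uniq // => k l; rewrite !mem_iota => hk hl hkl.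
    apply/eqP; rewrite eqn_leq; apply/andP; split; rewrite leqNgt; apply/negP=> kl.
      have lk : l < k < l + #|N| by move: hk hl kl nN; clear; lia.
      by move: (hinj l k lk); rewrite hkl eqxx.
    have lk : k < l < k + #|N| by move: hk hl kl nN; clear; lia.
      by move: (hinj k l lk); rewrite hkl eqxx.
  - by rewrite es => z /mapP[k _ ->].
  - by rewrite last_map last_iotaS.
have f1 i : ~~ A i -> B (i + e.-1).
  move=> nA; apply/negP=> nB; have en : e.-1 < #|N| by rewrite prednK.
  have [w1 w2 w3 w4] := win i e.-1 en.
  apply: (no_chain w1 w2 w3); rewrite /= ?size_map ?size_iota ?prednK //.
    by move: nA; rewrite negbK.
  by rewrite w4.
have BnA i : B i -> ~~ A i by move=> /AB->.
have iterB k i : B i -> B (i + k * e.-1).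
  elim: k => [|k IH] Bi; first by rewrite mul0n addn0.
  by rewrite mulSn addnCA addnC; apply: f1; apply: BnA; apply: IH.
have nAB i : ~~ A i -> B i.
  (* Altogether [#|N|] shifts by [e - 1] lead back to the same vertex. *)
  move=> /f1 /(iterB #|N|.-1); rewrite -addnA -mulSn prednK // mulnC /B hper' //.
have allB : (forall i, B i -> B i.+1) -> False.
  move=> step; have [i hi] := hsurj a aN; have [j hj] := hsurj b bN.
  have Bi : B i by apply: nAB; rewrite /A hi sa.
  have Bk k : B (i + k) by elim: k => [|k IH]; rewrite ?addn0 // addnS; apply: step.
  have := Bk (j + i * #|N| - i).
  have -> : i + (j + i * #|N| - i) = j + i * #|N|.
    by rewrite subnKC // (leq_trans _ (leq_addl _ _)) // leq_pmulr.
  by rewrite /B hper' hj eb.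
(* If [e = #|N|], then [e - 1] shifts by [e - 1] amount to a shift by [1], since [(e - 1)^2] is [1]
   modulo [e]. *)
move: (eN); rewrite leq_eqVlt => /orP[/eqP el|el].
  apply: allB => i /(iterB e.-1).
  have -> : i + e.-1 * e.-1 = i.+1 + (e - 2) * #|N|.
    by rewrite -el; case: (e) e0 el N1 => [|[|m]] // _ <- // _;
      rewrite /= subn2 /= !mulSn mulnS; lia.
  by rewrite /B hper'.
apply: allB => i Bi; have : B (i + e).
  apply: nAB; apply/negP=> Ae; have [w1 w2 w3 w4] := win i e el.
  by apply: (no_drop w1 w2 w3); rewrite ?size_map ?size_iota // w4.
(* These shifts amount to [- (e - 1)] modulo [#|N|], so after the shift by [e] they arrive at
   [i + 1]. *)
move/(iterB #|N|.-1).
have -> : i + e + #|N|.-1 * e.-1 = i.+1 + e.-1 * #|N|.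
  by case: (e) e0 => // e' _; case: #|N| l0 => // l _; rewrite /= mulnS mulnC; clear; lia.
by rewrite /B hper'.
Qed.

(** Let [C1] be a least nonempty subset of [N] that no arc enters from the rest of [N]; it is
    strong. If it is not all of [N], it has a Hamiltonian path from a good start, the rest [N2] has
    one to a good end, and all arcs lead from [C1] to [N2]. *)
Lemma rest_contradiction : False.
Proof.
pose P (C : {set V}) := [&& C != set0, C \subset N & [forall u in N :\: C, forall w in C,
  ~~ t u w]].
have PN : P N.
  by rewrite /P rest_neq0 subxx; apply/forall_inP=> u; rewrite setDv inE.
case: (arg_minnP (fun C : {set V} => #|C|) PN) => C1 /and3P[C10 C1N /forall_inP clo1] min1.
have {}clo1 u w : u \in N :\: C1 -> w \in C1 -> ~~ t u w.
  by move=> uN wC; have /forall_inP/(_ w wC) := clo1 u uN.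
have con1 (C : {set V}) : C \subset C1 -> C != set0 -> C != C1 ->
    exists u w, [/\ u \in C, w \in C1 :\: C & t u w].
  move=> CC1 C0 Cne.
  have [/existsP[u /existsP[w /and3P[? ? ?]]]|none] := boolP
    [exists u, exists w, [&& u \in C, w \in C1 :\: C & t u w]]; first by exists u, w.
  have prop : C \proper C1 by rewrite properEneq Cne.
  (* With no arc from [C] to the rest of [C1], that rest would be a smaller choice for [C1]. *)
  have : P (C1 :\: C).
    apply/and3P; split.
    - by rewrite setD_eq0; move: prop; rewrite properE => /andP[].
    - by apply: subset_trans C1N; apply: subsetDl.
    - apply/forall_inP=> u; rewrite in_setD in_setD negb_and negbK => /andP[uC uN].
      apply/forall_inP=> w wC; have wC1 : w \in C1 by move: wC; rewrite in_setD => /andP[].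
      case/orP: uC => uC; last by apply: clo1 => //; rewrite in_setD uC.
      apply/negP=> uw; case/existsP: none; exists u; apply/existsP; exists w.
      by rewrite uC wC.
  move/min1; have := cardsID C C1; rewrite (setIidPr CC1).
  have : 0 < #|C| by rewrite card_gt0.
  clear; lia.
have [eC1|neC1] := eqVneq C1 N; first by apply: rest_not_strong; rewrite -eC1.
have [a aC1 sa] := source_start C1N C10 clo1.
have [p1 [pp1 up1 ep1]] : exists p1, [/\ path t a p1, uniq (a :: p1) & (a :: p1) =i C1].
  apply: (hamilton_from tT aC1) => C CC1 aC Cne; apply: con1 => //.
  by apply/set0Pn; exists a.
pose N2 := N :\: C1.
have N20 : N2 != set0.
  by rewrite setD_eq0; apply: contra neC1 => h; rewrite eqEsubset C1N h.
have arc u w : u \in C1 -> w \in N2 -> t u w.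
  move=> uC wN; apply: (tourN tT) (clo1 w u wN uC).
  by apply: contraTneq uC => <-; move: wN; rewrite in_setD => /andP[].
pose P2 (C : {set V}) := [&& C != set0, C \subset N2 & [forall u in N :\: C, forall w in
  C, ~~ t w u]].
have PN2 : P2 N2.
  rewrite /P2 N20 subxx; apply/forall_inP=> u;
    rewrite in_setD in_setD negb_and negbK => /andP[uC uN].
  apply/forall_inP=> w wN2; apply: clo1 => //; case/orP: uC => //.
  by rewrite uN.
case: (arg_minnP (fun C : {set V} => #|C|) PN2) => C2 /and3P[C20 C2N /forall_inP clo2] min2.
have {}clo2 u w : u \in N :\: C2 -> w \in C2 -> ~~ t w u.
  by move=> uN wC; have /forall_inP/(_ w wC) := clo2 u uN.
have N2N : N2 \subset N by apply: subsetDl.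
have [b bC2 eb] := sink_end (subset_trans C2N N2N) C20 clo2.
have bN2 := subsetP C2N b bC2.
have [a2 [p2 [pp2 lp2 up2 ep2]]] : exists a p2,
    [/\ path t a p2, last a p2 = b, uniq (a :: p2) & (a :: p2) =i N2].
  (* Suppose that no arc enters [C]. If [C2] lies in [C], a vertex outside [C] dominates [b],
     because no arc leaves [C2]; otherwise [C2 :\: C] is a smaller choice for [C2]. *)
  apply: (hamilton_to tT bN2) => C CN2 bC Cne.
  have [/existsP[u /existsP[w /and3P[? ? ?]]]|none] := boolP
    [exists u, exists w, [&& u \in C, w \in N2 :\: C & t w u]]; first by exists u, w.
  exfalso.
  have {}none u w : u \in C -> w \in N2 -> w \notin C -> ~~ t w u.
    move=> uC wN2 wC; apply/negP=> wu; case/existsP: none; exists u; apply/existsP; exists w.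
    by rewrite in_setD uC wN2 wC.
  have [C2C|C2C] := boolP (C2 \subset C).
    have [w wC wN2] : exists2 w, w \notin C & w \in N2.
      have : ~~ (N2 \subset C) by apply: contra Cne => h; rewrite eqEsubset CN2 h.
      by case/subsetPn=> w ? ?; exists w.
    have wC2 : w \notin C2 by apply: contra wC; apply: (subsetP C2C).
    have h1 : ~~ t b w by apply: clo2 => //; rewrite in_setD wC2 (subsetP N2N).
    have := none b w bC wN2 wC; rewrite (tourN tT _ h1) //.
    by apply: contraNneq wC => <-.
  have : P2 (C2 :\: C).
    apply/and3P; split.
    - by rewrite setD_eq0.
    - by apply: subset_trans C2N; apply: subsetDl.
    - apply/forall_inP=> u; rewrite in_setD in_setD negb_and negbK => /andP[uC uN].
      apply/forall_inP=> w; rewrite in_setD => /andP[wC wC2].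
      case/orP: uC => uC; last by apply: clo2 => //; rewrite in_setD uC.
      by apply: none => //; apply: (subsetP C2N).
  move/min2; have := cardsID C C2.
  have : 0 < #|C2 :&: C| by apply/card_gt0P; exists b; rewrite in_setI bC2.
  clear; lia.
have sz1 : (size p1).+1 = #|C1| by rewrite -(eq_card ep1) (card_uniqP up1).
have sz2 : (size p2).+1 = #|N2| by rewrite -(eq_card ep2) (card_uniqP up2).
have szN : #|C1| + #|N2| = #|N| by have := cardsID C1 N; rewrite (setIidPr C1N).
(* A single vertex must serve as both ends. If neither [a] nor [b] does, the arc [a -> b] replaces
   an inner vertex. *)
have [e1|e2] := leqP e 1.
  have ee : e = 1 by move: e0 e1; clear; lia.
  have na : ~~ end_ok t y s a.
    apply/negP=> ea; apply: (@no_chain a [::]) => //.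
    by move=> z; rewrite inE => /eqP->; apply: (subsetP C1N).
  have nb : ~~ start_ok t x s b.
    apply/negP=> sb; apply: (@no_chain b [::]) => //.
    by move=> z; rewrite inE => /eqP->; apply: (subsetP N2N).
  have ab := arc a b aC1 bN2.
  apply: (@no_drop a [:: b]) => //.
  - by rewrite /= ab.
  - by rewrite /= inE (tour_neq tT ab).
  - by move=> z; rewrite !in_cons in_nil orbF => /orP[]/eqP->;
      [apply: (subsetP C1N)|apply: (subsetP N2N)].
(* The chain takes [j] vertices from the end of the second path and [e - j], at least one, from the
   start of the first. *)
pose j := minn e.-1 #|N2|; pose k := #|N2| - j.
have j0 : 0 < j by rewrite /j; move: e2 sz2; clear; lia.
have kj : k < size (a2 :: p2) by rewrite /= sz2 /k; move: j0 sz2; clear; lia.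
pose c1 := take (e - j).-1 p1; pose c2 := drop k (a2 :: p2).
have ec2 : c2 = nth a2 (a2 :: p2) k :: drop k.+1 (a2 :: p2) by rewrite /c2 (drop_nth a2).
have c1C : {subset a :: c1 <= C1}.
  by move=> z; rewrite -ep1 !inE => /orP[->//|/mem_take->]; rewrite orbT.
have c2N : {subset c2 <= N2} by move=> z /mem_drop; rewrite ep2.
apply: (@no_chain a (c1 ++ c2)) => //.
- rewrite cat_path; apply/andP; split.
    by move: pp1; rewrite -{1}(cat_take_drop (e - j).-1 p1) cat_path => /andP[].
  rewrite ec2 /=; apply/andP; split.
    by apply: arc; [apply: c1C; apply: mem_last|rewrite -ep2 mem_nth].
  have : path t a2 (take k p2 ++ drop k p2) by rewrite cat_take_drop.
  rewrite cat_path => /andP[_]; congr (path t _ _).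
  rewrite -nth_last size_takel; last by move: kj; rewrite /= ltnS.
  by case: (k) kj => [|k'] kk; rewrite ?take0 //= nth_take.
- rewrite -cat_cons cat_uniq; apply/and3P; split.
  + by have := take_uniq (e - j) up1; rewrite /c1; case: (e - j) => [|m] //= _; rewrite take0.
  + apply/hasPn=> z /c2N; rewrite in_setD => /andP[zC _]; apply: contra zC; exact: c1C.
  + exact: drop_uniq.
- move=> z; rewrite -cat_cons mem_cat => /orP[/c1C|/c2N];
    [exact: (subsetP C1N)|exact: (subsetP N2N)].
- rewrite /= size_cat size_takel /c2 ?size_drop /=; rewrite /k /j; move: eN e2 sz1 sz2 szN;
    clear; lia.
- rewrite last_cat.
  have -> : last (last a c1) c2 = last a2 (a2 :: p2).
    by rewrite -[in RHS](cat_take_drop k (a2 :: p2)) last_cat -/c2 ec2.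
  by rewrite /= lp2.
Qed.

End Triple.

Lemma has_inner_of_triple (V : finType) (t : rel V) (D : {set V}) (d : nat) (x y : V) (p
  q r : seq V) e :
  tournament t -> mindeg t D d -> 4 <= d -> #|D| + 1 <= 3 * d ->
  x \in D -> y \in D -> x != y -> three_disjoint t D x y p q r ->
  size (p ++ q ++ r) + e + 2 <= #|D| ->
  has_inner t D x y (size (p ++ q ++ r) + e).
Proof.
move=> tT md d4 mD xD yD xy td sz.
case: (posnP e) => [->|e0].
  rewrite addn0; case: td => [[pp pq pr] _ u sD]; apply: linked_has_inner => //.
  apply: linked_merge => //; first exact: pth_linked.
  apply: linked_merge => //; try exact: pth_linked.
  by move: u; rewrite cat_uniq => /and3P[].
have [//|no] := has_inner_dec t D x y (size (p ++ q ++ r) + e).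
exfalso; apply: (rest_contradiction tT md d4 mD xD yD xy td e0 _ no).
case: td => _ _ u sD; have := card_outside xD yD xy u sD; move: sz; clear; lia.
Qed.

(** * Shortening three disjoint paths *)

Section Triples.
Variables (V : finType) (t : rel V) (D : {set V}) (x y : V).
Let Dxy := D :\: [set x; y].
Implicit Types p q r : seq V.
Local Notation td := (three_disjoint t D x y).

Lemma three_disjoint_rot p q r : td p q r -> td q r p.
Proof.
have e : perm_eq (q ++ r ++ p) (p ++ q ++ r).
  by apply/permP=> f; rewrite !count_cat; clear; lia.
case=> [[pp pq pr] [p0 q0 r0] u sD]; split=> //; first by rewrite (perm_uniq e).
by move=> z; rewrite (perm_mem e) => /sD.
Qed.

Definition total_size (p q r : seq V) := size p + size q + size r.

Lemma longest_last p q r : td p q r -> exists p' q' r',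
  [/\ td p' q' r', total_size p' q' r' = total_size p q r, size p' <= size r' & size q'
    <= size r'].
Proof.
move=> h; have h1 := three_disjoint_rot h; have h2 := three_disjoint_rot h1.
have [/andP[? ?]|] := boolP ((size p <= size r) && (size q <= size r)); first by exists p, q, r.
have [/andP[? ?] _|] := boolP ((size q <= size p) && (size r <= size p)).
  by exists q, r, p; split=> //; rewrite /total_size; clear; lia.
have [/andP[? ?] _ _|] := boolP ((size r <= size q) && (size p <= size q)).
  by exists r, p, q; split=> //; rewrite /total_size; clear; lia.
clear; lia.
Qed.

Lemma three_disjoint_sub p q r p' : td p q r -> pth t x y p' -> p' != [::] ->
  subseq p' p -> td p' q r.
Proof.
case=> [[pp pq pr] [p0 q0 r0] u sD] pp' p0' ss.
have sub : subseq (p' ++ q ++ r) (p ++ q ++ r) by apply: cat_subseq.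
by split=> //; [apply: subseq_uniq u|move=> z /(mem_subseq sub)/sD].
Qed.

(** The first and the last inner vertex are left out because their arcs from [x] and to [y] belong
    to the path itself. *)
Definition shortcut p := has (t x) (behead p) || has (fun z => t z y) (take (size p).-1 p).

Lemma three_disjoint_shorten p q r : td p q r -> shortcut p ->
  exists2 p', td p' q r & size p' < size p.
Proof.
move=> h; have [[pp _ _] [p0 _ _] _ _] := h.
case/orP=> /hasP[z zp zt].
  case: p p0 pp h zp => // h0 p' _ pp h /= zp.
  case/splitPr: zp pp h => a b pp h; exists (z :: b); last by rewrite /= size_cat /=;
    clear; lia.
  apply: (three_disjoint_sub h) => //.
    by move: pp; rewrite -cat_cons pth_split /pth /= zt => /andP[].
  by rewrite -cat_cons suffix_subseq.
have [a [b [ep b0]]] : exists a b, p = a ++ z :: b /\ b != [::].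
  move: (cat_take_drop (size p).-1 p); case/splitPr: zp => a b e0.
  exists a, (b ++ drop (size p).-1 p); split; first by rewrite -{1}e0 -catA.
  apply/eqP=> /(congr1 (@size V)); rewrite size_cat size_drop /=.
  by case: (p) p0 => //= a0 p' _; clear; lia.
exists (rcons a z); last first.
  by rewrite ep size_rcons size_cat /=; case: (b) b0 => //= b1 b' _;
    rewrite !addnS !ltnS leq_addr.
apply: (three_disjoint_sub h).
- by move: pp; rewrite ep pth_split /pth => /andP[pa _]; rewrite rcons_path last_rcons pa.
- by rewrite -size_eq0 size_rcons.
- by rewrite ep -cat_rcons prefix_subseq.
Qed.

Lemma count_shortcut p : p != [::] -> ~~ shortcut p ->
  count (t x) p <= 1 /\ count (fun z => t z y) p <= 1.
Proof.
rewrite negb_or !has_count -!eqn0Ngt => p0 /andP[/eqP h1 /eqP h2]; split.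
  by case: (p) p0 h1 => //= a p' _ ->; rewrite addn0 leq_b1.
rewrite -(cat_take_drop (size p).-1 p) count_cat h2 add0n.
apply: leq_trans (count_size _ _) _; rewrite size_drop; clear; lia.
Qed.

End Triples.

(** * Long paths from three disjoint paths *)

Section Main.
Variables (V : finType) (t : rel V) (D : {set V}) (d : nat) (x y : V).
Hypotheses (tT : tournament t) (md : mindeg t D d) (d4 : 4 <= d).
Hypotheses (mD : #|D| + 1 <= 3 * d) (xD : x \in D) (yD : y \in D) (xy : x != y).

Implicit Types p q r : seq V.

(** The paths [p] and [q] are merged into [R], and [interpolate] adds all but [dl] vertices of
    [r]. *)
Lemma interpolate_triple p q r k dl : three_disjoint t D x y p q r ->
  total_size p q r = k + dl -> size p + size q <= k -> 0 < dl ->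
  dl <= 2 \/ (dl = 3 /\ k = 6) -> has_inner t D x y k.
Proof.
case=> [[pp pq pr] [p0 q0 r0] u sD] eT pqk dl0 hd.
have upq : uniq (p ++ q).
  by move: u; rewrite catA cat_uniq => /and3P[].
have Lpq := linked_merge tT (pth_linked pp) (pth_linked pq) upq.
have pqD : {subset p ++ q <= D :\: [set x; y]}.
  by move=> z zpq; apply: sD; rewrite catA mem_cat zpq.
have p1 : 0 < size p by case: (p) p0.
have q1 : 0 < size q by case: (q) q0.
pose e := k - (size p + size q).
have ek : size p + size q + e = k by rewrite subnKC.
case: (posnP e) => [e0|e0].
  have -> : k = size (p ++ q) by rewrite size_cat -ek e0 addn0.
  exact: linked_has_inner.
have [R pR eR] := Lpq; have szR : size R = size p + size q by rewrite (perm_size eR) size_cat.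
have sc : e + dl = size r by move: eT ek; rewrite /total_size; clear; lia.
have eRr : perm_eq (R ++ r) (p ++ q ++ r) by rewrite catA perm_cat2r.
have uRr : uniq (R ++ r) by rewrite (perm_uniq eRr).
have sRr : {subset R ++ r <= D :\: [set x; y]} by move=> z; rewrite (perm_mem eRr) => /sD.
have R0 : R != [::] by rewrite -size_eq0 szR; move: p1; clear; lia.
(* For [dl = 3] and [k = 6] this settles [e = 3], which [interpolate] does not cover. *)
have [e3|ne3] := eqVneq (size r) k.
  rewrite -e3; apply: linked_has_inner; first exact: pth_linked.
    by move: uRr; rewrite cat_uniq => /and3P[].
  by move=> z zr; apply: sRr; rewrite mem_cat zr orbT.
rewrite -ek -szR; apply: (interpolate tT pR pr uRr sRr R0 sc e0 dl0).
case: hd => [dl2|[dl3 k6]]; first by left; split=> //; rewrite szR; move: p1 q1 dl2; clear; lia.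
right; split=> //; rewrite szR; move: ne3 p1 q1 e0 ek sc; rewrite dl3 k6; clear; lia.
Qed.

(** Induction on the total size of the triple. Up to [k] it is filled up, for [k + 1] and [k + 2] it
    is interpolated, and beyond that it is shortened, with one exceptional case. *)
Lemma has_inner_large k p q r : three_disjoint t D x y p q r ->
  2 * d <= k + 2 -> k + 2 <= #|D| -> has_inner t D x y k.
Proof.
move=> + dk kD; have [n] := ubnP (total_size p q r); elim: n p q r => // n IH p q r.
move=> tn h0; have [p' [q' [r' [h et pr qr]]]] := longest_last h0.
move: tn; rewrite -et; move: h pr qr {h0 et} => {p q r}; move: p' q' r' => p q r h pr qr tn.
have [hp [p0 q0 r0] u sD] := h.
have stot : size (p ++ q ++ r) = total_size p q r by rewrite !size_cat /total_size addnA.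
case: (leqP (total_size p q r) k) => [tk|kt].
  have -> : k = size (p ++ q ++ r) + (k - total_size p q r) by rewrite stot subnKC.
  apply: (has_inner_of_triple tT md d4 mD xD yD xy h).
  by rewrite stot subnKC.
have [t2|t3] := leqP (total_size p q r) (k + 2).
  apply: (@interpolate_triple p q r k (total_size p q r - k)) => //.
  - by rewrite subnKC // ltnW.
  - by move: t2 pr qr dk d4; rewrite /total_size; clear; lia.
  - by rewrite subn_gt0.
  - by left; move: t2; clear; lia.
pose N := [set v in D :\: [set x; y] | v \notin p ++ q ++ r].
have cN : #|N| + size (p ++ q ++ r) + 2 = #|D| := card_outside xD yD xy u sD.
have [sp|sp] := boolP (shortcut t x y p).
  have [p' h' sz] := three_disjoint_shorten h sp.
  by apply: (IH p' q r) => //; move: sz tn; rewrite /total_size; clear; lia.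
have [sq|sq] := boolP (shortcut t x y q).
  have [q' h' sz] := three_disjoint_shorten (three_disjoint_rot h) sq.
  by apply: (IH q' r p) => //; move: sz tn; rewrite /total_size; clear; lia.
have [sr|sr] := boolP (shortcut t x y r).
  have [r' h' sz] := three_disjoint_shorten (three_disjoint_rot (three_disjoint_rot h)) sr.
  by apply: (IH r' p q) => //; move: sz tn; rewrite /total_size; clear; lia.
have [cpx cpy] := count_shortcut p0 sp; have [cqx cqy] := count_shortcut q0 sq.
have [crx cry] := count_shortcut r0 sr.
have hx := count_out_x tT md xD u sD; have hy := count_in_y tT md yD u sD.
rewrite -/N !count_cat in hx hy.
(* Without shortcuts [x] dominates at most one vertex of each path, so at least [d - 4] vertices of
   [N]. As [N] has at most [d - 4] vertices, [x] dominates all of it; likewise all of [N] dominates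
   [y]. *)
have sub (Q : pred V) : d <= #|[set w in N | Q w]| + 4 -> [set w in N | Q w] = N.
  move=> hQ; apply/eqP; rewrite eqEcard; apply/andP; split.
    by apply/subsetP=> z; rewrite inE => /andP[].
  by move: hQ cN mD t3 dk; rewrite stot; clear; lia.
have NX := sub (t x) _; have NY := sub (fun z => t z y) _.
have {}NX : [set w in N | t x w] = N by apply: NX; move: hx cpx cqx crx; clear; lia.
have {}NY : [set w in N | t w y] = N by apply: NY; move: hy cpy cqy cry; clear; lia.
(* If [N] is empty, then [d = 4], [k = 6] and the total size is [9], the exceptional case. *)
have [N0|[n0 nN]] := set_0Vmem N.
  rewrite NX N0 cards0 in hx; rewrite N0 cards0 stot in cN.
  apply: (@interpolate_triple p q r k 3) => //.
  - by move: hx cpx cqx crx cN mD t3 dk d4; clear; lia.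
  - by move: cpx cqx crx hx cN mD t3 dk d4 pr qr; rewrite /total_size; clear; lia.
  - by right; split=> //; move: hx cpx cqx crx cN mD t3 dk d4; clear; lia.
have xn : t x n0 by move: nN; rewrite -NX inE => /andP[].
have ny : t n0 y by move: nN; rewrite -NY inE => /andP[].
have [nD ns] : n0 \in D :\: [set x; y] /\ n0 \notin p ++ q ++ r by move: nN;
  rewrite inE => /andP.
(* The longest path has at least three inner vertices and is exchanged for [x -> n0 -> y]. *)
apply: (IH p q [:: n0]).
  by move: tn pr qr t3 dk d4; rewrite /total_size /=; clear; lia.
case: hp => pp pq _; split=> //.
- by split=> //; rewrite /pth /= xn ny.
- move: u ns; rewrite !catA => u ns; rewrite cat_uniq /= orbF andbT.
  move: u; rewrite cat_uniq => /and3P[-> _ _] /=.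
  by apply: contra ns => h'; rewrite mem_cat h'.
- move=> z; rewrite catA mem_cat => /orP[zpq|]; first by apply: sD; rewrite catA mem_cat zpq.
  by rewrite inE => /eqP->.
Qed.

End Main.

(** * The growth step and its transfer to regular tournaments *)

Lemma inner_path_converse (V : finType) (t : rel V) (D : {set V}) x y p :
  inner_path t D x y p -> inner_path (converse t) D y x (rev p).
Proof.
case=> pp up pD; split; first by rewrite pth_converse.
  by rewrite rev_uniq.
by move=> z; rewrite mem_rev setUC => /pD.
Qed.

Lemma grow_inner (V : finType) (t : rel V) (D : {set V}) (d : nat) (x y : V) (k : nat) :
  tournament t -> mindeg t D d -> 4 <= d -> #|D| + 1 <= 3 * d ->
  x \in D -> y \in D -> x != y -> 2 <= k -> k + 3 <= #|D| ->
  has_inner t D x y k -> has_inner t D x y k.+1.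
Proof.
move=> tT md d4 mD xD yD xy k2 kD [p ip szp]; rewrite -{}szp in k2 kD *.
have [//|no] := has_inner_dec t D x y (size p).+1.
have [_ up pD] := ip.
pose W := [set u in D :\: [set x; y] | u \notin p].
have both := grow_both_outside tT md mD xD yD xy ip k2 no; rewrite -/W in both.
have dp : [set w in W | t x w] = set0 \/ [set w in W | t w y] = set0 -> d <= (size p).+1.
  have hx := count_out_x tT md xD up pD; have hy := count_in_y tT md yD up pD.
  rewrite -/W in hx hy.
  have := count_size (t x) p; have := count_size (fun z => t z y) p.
  by move=> ? ? [] e; [rewrite e cards0 in hx|rewrite e cards0 in hy]; lia.
have [x0|x0] := eqVneq [set w in W | t x w] set0; last first.
  have [y0|y0] := eqVneq [set w in W | t w y] set0; last by case: (both x0 y0).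
  (* Only an outneighbour of [x] is missed: [grow_y_outside] applies to the reversed path. *)
  exfalso.
  have yx : y != x by rewrite eq_sym.
  have no' : ~ has_inner (converse t) D y x (size (rev p)).+1.
    move=> [q iq szq]; apply: no; exists (rev q); last by rewrite size_rev szq size_rev.
    by have := inner_path_converse iq.
  have k2' : 2 <= size (rev p) by rewrite size_rev.
  have kD' : size (rev p) + 3 <= #|D| by rewrite size_rev.
  have dp' : d <= (size (rev p)).+1 by rewrite size_rev; apply: dp; right.
  have := @grow_y_outside V (converse t) D d y x (converse_tournament tT)
    (mindeg_converse md) d4 mD yD xD yx (rev p) (inner_path_converse ip) k2' kD' no' dp'.
  have -> : [set u in D :\: [set y; x] | u \notin rev p] = W.
    by apply/setP=> u; rewrite setUC !inE mem_rev.
  by apply.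
have dp' := dp (or_introl x0).
have [y0|y0] := eqVneq [set w in W | t w y] set0; last first.
  by case: (grow_y_outside tT md d4 mD xD yD xy ip k2 kD no dp' x0 y0).
have h := grow_none_outside tT md d4 mD xD yD xy ip k2 kD no dp' x0 y0.
(* By [h] the wanted number [(size p).+1] of inner vertices is at least [2 d - 2]. *)
have [p1 [q1 [r1 td]]] := three_disjoint_paths tT md d4 mD xD yD xy.
by apply: (has_inner_large tT md d4 mD xD yD xy td); move: h kD; clear; lia.
Qed.

Lemma is_tournamentP (V : finType) (t : rel V) : is_tournament t -> tournament t.
Proof.
move=> [t0 tt]; split=> [v|u v uv]; first exact: negbTE.
by have := tt u v uv; case: (t u v); case: (t v u).
Qed.

Lemma outdegD (V : finType) (t : rel V) v : tournament t ->
  outdeg t v + indeg t v + 1 = #|V|.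
Proof.
move=> tT; rewrite -(cards1 v) -cardsT /outdeg /indeg.
have d1 : [set w | t v w] :&: [set w | t w v] = set0.
  by apply/setP=> w; rewrite !inE; apply/negP=> /andP[/(tourF tT)->].
have d2 : ([set w | t v w] :|: [set w | t w v]) :&: [set v] = set0.
  by apply/setP=> w; rewrite !inE; apply/negP=> /andP[+ /eqP ew]; rewrite ew !(proj1 tT).
rewrite -cardsUI d1 cards0 addn0 -cardsUI d2 cards0 addn0; apply: eq_card => w.
rewrite !inE; have [//|wv] := eqVneq w v; first by rewrite orbT.
by rewrite orbF (proj2 tT w v wv) orbN.
Qed.

Lemma mindeg_avoid (V : finType) (t : rel V) (S : {set V}) n :
  tournament t -> is_regular t -> #|V| = 2 * n + 1 -> mindeg t (~: S) (n - #|S|).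
Proof.
move=> tT reg cV v _.
have dv : outdeg t v = n by have := outdegD v tT; have := reg v; rewrite cV; clear; lia.
have dv' : indeg t v = n by rewrite -reg.
have sub (r : rel V) : #|[set w | r v w]| - #|S| <= outin r (~: S) v.
  rewrite leq_subLR addnC /outin; apply: leq_trans (leq_card_setU _ _).
  apply/subset_leq_card/subsetP=> w; rewrite !inE => ->.
  by case: (w \in S).
split; first by rewrite -{1}dv; apply: sub.
by rewrite -{1}dv'; apply: (sub (converse t)).
Qed.

Lemma has_path_inner (V : finType) (t : rel V) (S : {set V}) x y k :
  x \notin S -> y \notin S -> x != y ->
  has_path_of_length t S x y k.+1 <-> has_inner t (~: S) x y k.
Proof.
move=> xS yS xy; split.
  move=> [p [[pp up lp /allP sp] sz]]; case/lastP: p pp up lp sp sz => // p z pp up.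
  rewrite last_rcons size_rcons => ez; rewrite {}ez in pp up * => sp [sz].
  move: up; rewrite /= rcons_uniq mem_rcons inE negb_or => /and3P[/andP[_ xp] yp up].
  exists p => //; split=> // w wp; rewrite !inE negb_or.
  have -> : w != x by apply: contraNneq xp => <-.
  have -> : w != y by apply: contraNneq yp => <-.
  by apply: sp; rewrite inE mem_rcons inE wp !orbT.
move=> [p [pp up sp] sz]; exists (rcons p y); split; last by rewrite size_rcons sz.
have pxy w : w \in p -> [/\ w != x, w != y & w \notin S].
  by move/sp; rewrite !inE negb_or -andbA => /and3P[].
split=> //; last first.
- apply/allP=> w; rewrite inE mem_rcons inE => /or3P[/eqP->//|/eqP->//|/pxy[]//].
- by rewrite last_rcons.
rewrite /= rcons_uniq mem_rcons inE negb_or xy up andbT /=; apply/andP; split.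
  by apply/negP=> /pxy[]; rewrite eqxx.
by apply/negP=> /pxy[_]; rewrite eqxx.
Qed.

Theorem theorem1p5 (V : finType) (t : rel V) (n : nat) (S : {set V}) (x y : V) (r : nat) :
  is_tournament t -> is_regular t ->
  #|V| = 2 * n + 1 -> 11 <= 2 * n + 1 ->
  2 * #|S| <= n - 2 ->
  x \notin S -> y \notin S -> x != y ->
  3 <= r -> r <= 2 * n - #|S| - 1 ->
  has_path_of_length t S x y r ->
  has_path_of_length t S x y r.+1.
Proof.
move=> /is_tournamentP tT reg cV n5 S2 xS yS xy r3 rn.
case: r r3 rn => // k k2 kn /(has_path_inner t k xS yS xy) h.
have cD : #|~: S| = 2 * n + 1 - #|S| by rewrite -cV cardsCs setCK.
(* With [d = n - #|S|] and [2 n + 1 - #|S|] vertices, the bound on [#|S|] is equivalent to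
   [#|~: S| + 1 <= 3 d]; together with [n >= 5] it gives [d >= 4]. *)
apply/(has_path_inner t k.+1 xS yS xy); apply: (grow_inner tT (mindeg_avoid tT reg cV)) h => //.
- by move: n5 S2; clear; lia.
- by rewrite cD; move: n5 S2; clear; lia.
- by rewrite inE.
- by rewrite inE.
- by rewrite cD; move: n5 S2 kn; clear; lia.
Qed.
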